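(* Let $X$ be a non-empty set. For a positive definite kernel $K\colon X\times X\to\mathbb C$ the following conditions are equivalent: (i) $K$ has a unique positive definite matrix-type square root (that is, exactly one such root exists); (ii) each positive definite kernel $L\colon X\times X\to\mathbb C$ such that $L\ll K$ has a positive definite matrix-type square root; (iii) $K\ll c\,\delta_X$ for some constant $c>0$.
   Context: A kernel on $X$ is a function $K\colon X\times X\to\mathbb C$. It is positive definite if $\sum_{j,k=1}^n\lambda_j\overline{\lambda_k}K(x_j,x_k)\ge 0$ (in particular real) for all $n\ge1$, $x_1,\ldots,x_n\in X$, $\lambda_1,\ldots,\lambda_n\in\mathbb C$. For kernels $K,L$ on $X$, $K\ll L$ means that $L-K$ is a positive definite kernel. $\delta_X$ is the kernel on $X$ with $\delta_X(x,y)=1$ if $x=y$ and $0$ otherwise. A positive definite kernel $M$ on $X$ is a positive definite matrix-type square root of a positive definite kernel $L$ on $X$ if for all $x,z\in X$: $L(x,z)=\sum_{y\in X}M(x,y)M(y,z)$. (Since $M(y,x)=\overline{M(x,y)}$, for $z=x$ the series has non-negative terms; its finiteness for all $x$ gives $M(x,\cdot)\in\ell_2(X)$ and absolute convergence for all $x,z$.) *)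

(* Defs.v *)
From HB Require Import structures.
From mathcomp Require Import all_boot all_order all_algebra.
From mathcomp Require Import finmap complex.
From mathcomp Require Import all_classical all_reals all_analysis.
From mathcomp Require Import showcase.summability.

Set Implicit Arguments.
Unset Strict Implicit.
Unset Printing Implicit Defensive.

Import Order.TTheory GRing.Theory Num.Theory.
Import numFieldNormedType.Exports.

Local Open Scope classical_set_scope.
Local Open Scope ring_scope.

(* X may be uncountable: the sum over X is the limit of the partial sums along
   the directed family of finite subsets of X.  Over the complex numbers this
   kind of convergence is the same as absolute convergence. *)
Definition has_sum (F : numFieldType) (X : choiceType) (f : X -> F) (s : F) :
  Prop := partial_sum f @ totally --> s.

Section Kernels.
Variables (R : realType) (X : choiceType).

Implicit Types K L M : X -> X -> R[i].

(* In R[i], 0 <= z means that z is real and non-negative. *)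
Definition posdef K : Prop :=
  forall (n : nat) (x : 'I_n.+1 -> X) (lambda : 'I_n.+1 -> R[i]),
    0 <= \sum_(j < n.+1) \sum_(k < n.+1)
           lambda j * (lambda k)^* * K (x j) (x k).

Definition dominated K L : Prop := posdef (fun x y => L x y - K x y).

Definition delta : X -> X -> R[i] := fun x y => (x == y)%:R.

Definition matrix_sqrt M L : Prop :=
  posdef M /\ forall x z, has_sum (fun y => M x y * M y z) (L x z).

End Kernels.

Arguments delta : clear implicits.

(* Main.v *)
From HB Require Import structures.
Require Import Defs.
From mathcomp Require Import all_boot all_order all_algebra.
From mathcomp Require Import finmap complex.
From mathcomp Require Import all_classical all_reals all_analysis.
From mathcomp Require Import showcase.summability.
From mathcomp Require Import ring lra.

Set Implicit Arguments.
Unset Strict Implicit.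
Unset Printing Implicit Defensive.

Import Order.TTheory GRing.Theory Num.Theory.
Import numFieldNormedType.Exports.

Local Open Scope classical_set_scope.
Local Open Scope ring_scope.

(** Let [e x] be the standard basis of [l2 X].  The rows of a matrix square root
   [M] of [K] are square-summable: they are vectors [m x] whose Gram matrix is
   [K], by Parseval's identity, and [e x |-> m x] is a densely defined positive
   symmetric operator.

   If [K <= c delta], then [K] is the matrix of a bounded positive operator
   ([bounded_operator]), and so is every kernel below [K] and every root of [K].
   Hence a bounded kernel has a root ([bounded_root]) and only one
   ([root_unique]), by the existence and uniqueness of the positive square root
   of a bounded positive operator ([sqrt_op], [sqrt_op_unique]).

   Suppose now that [K] has a root [m] but is unbounded.  The uniform
   boundedness principle gives a vector [h] outside the domain of the adjoint of
   [e x |-> m x] ([unbounded_adjoint_dom]): no [v] in [l2 X] satisfies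
   [<m x, h> = <e x, v>] for all [x].

   - The kernel [a x * conj (a y)] with [a x = <m x, h> / |h|] is below [K] by
     the Cauchy-Schwarz inequality.  A root of it has rank one and is Hermitian,
     which forces [a] to be square-summable, against the choice of [h].  So some
     kernel below [K] has no root ([unbounded_no_root]).

   - The adjoint of [e x |-> m x], extended by [h |-> 0], is still a closed
     operator [T], because [h] is outside its domain.  Its absolute value [|T|]
     satisfies [<|T| (e x), |T| (e y)> = <m x, m y>] and is positive, so it gives
     a root [m'] of [K]; and [|T| h = 0], so all the vectors [m' x] are orthogonal
     to [h] ([second_root]).  If [K] had only one root then [m = m'] would be
     orthogonal to [h], and [v = 0] would contradict the choice of [h].

   Unbounded operators are avoided in the second construction.  With [P] the
   orthogonal projection onto the graph of [T], the operator [S k], defined as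
   the first component of [P (k, 0)], is [(1 + T^* T)^-1], and
   [C = (S - S ^ 2)^(1/2)] is [|T| S].  The vectors [P (k, 0)] are dense in the
   graph, and [m' x] is the limit of [C k] when [P (k, 0)] tends to
   [(e x, m x)].

   The operator theory is done in real Hilbert spaces, where quadratic forms take
   values in an ordered field.  A complex space is a real one with an isometry
   [J] of square [-1]; operators are complex linear when they commute with [J],
   which square roots do because they lie in the bicommutant. *)

(** * Real Hilbert spaces *)

Record hilbert (R : realType) := Hilbert {
  hilbert_car :> lmodType R;
  ip : hilbert_car -> hilbert_car -> R;
  ipC : forall u v, ip u v = ip v u;
  ipDl : forall u v w, ip (u + v) w = ip u w + ip v w;
  ipZl : forall a u w, ip (a *: u) w = a * ip u w;
  ip_ge0 : forall u, 0 <= ip u u;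
  ip_eq0 : forall u, ip u u = 0 -> u = 0;
  ip_complete : forall u : nat -> hilbert_car,
    (forall e, 0 < e -> exists N, forall m n, (N <= m)%N -> (N <= n)%N ->
       ip (u m - u n) (u m - u n) <= e) ->
    exists l, (fun n => ip (u n - l) (u n - l)) @ \oo --> (0 : R)
}.

Notation "'[ u , v ]" := (ip u v) : ring_scope.
Notation "'[ u ]" := (ip u u) : ring_scope.

Section HilbertTheory.
Variables (R : realType) (H : hilbert R).
Implicit Types (u v w l : H) (a : R) (s : nat -> H).

Lemma ipDr u v w : '[u, v + w] = '[u, v] + '[u, w].
Proof. by rewrite ipC ipDl !(ipC u). Qed.

Lemma ipZr a u v : '[u, a *: v] = a * '[u, v].
Proof. by rewrite ipC ipZl ipC. Qed.

Lemma ip0l u : '[0 : H, u] = 0.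
Proof. by rewrite -(scale0r (0 : H)) ipZl mul0r. Qed.

Lemma ip0r u : '[u, 0 : H] = 0.
Proof. by rewrite ipC ip0l. Qed.

Lemma ipNl u v : '[- u, v] = - '[u, v].
Proof. by rewrite -scaleN1r ipZl mulN1r. Qed.

Lemma ipNr u v : '[u, - v] = - '[u, v].
Proof. by rewrite ipC ipNl ipC. Qed.

Lemma ipBl u v w : '[u - v, w] = '[u, w] - '[v, w].
Proof. by rewrite ipDl ipNl. Qed.

Lemma ipBr u v w : '[u, v - w] = '[u, v] - '[u, w].
Proof. by rewrite ipDr ipNr. Qed.

Definition ipE :=
  (ipDl, ipDr, ipNl, ipNr, ipZl, ipZr, ip0l, ip0r).

Lemma nsqN u : '[- u] = '[u].
Proof. by rewrite !ipE opprK. Qed.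

Lemma nsqD u v : '[u + v] = '[u] + 2 * '[u, v] + '[v].
Proof. by rewrite !ipE (ipC v u); ring. Qed.

Lemma nsqB u v : '[u - v] = '[u] - 2 * '[u, v] + '[v].
Proof. by rewrite !ipE (ipC v u); ring. Qed.

Lemma ip_inj u v : (forall w, '[u, w] = '[v, w]) -> u = v.
Proof.
move=> uv; apply/eqP; rewrite -subr_eq0; apply/eqP/ip_eq0.
by rewrite ipBl uv subrr.
Qed.

Definition symop (A : H -> H) := forall u v, '[A u, v] = '[u, A v].
Definition posop (A : H -> H) := forall u, 0 <= '[A u, u].

(** A symmetric map defined everywhere is linear, because the inner product
   separates the vectors. *)
Lemma symopD A u v : symop A -> A (u + v) = A u + A v.
Proof. by move=> sA; apply: ip_inj => w; rewrite ipDl !sA ipDl. Qed.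

Lemma symopZ A a u : symop A -> A (a *: u) = a *: A u.
Proof. by move=> sA; apply: ip_inj => w; rewrite ipZl !sA ipZl. Qed.

Lemma symopN A u : symop A -> A (- u) = - A u.
Proof. by move=> sA; rewrite -scaleN1r symopZ// scaleN1r. Qed.

Lemma symopB A u v : symop A -> A (u - v) = A u - A v.
Proof. by move=> sA; rewrite symopD// symopN. Qed.

Lemma quad_discr (x y z : R) :
  0 <= x -> (forall t, 0 <= x * t ^+ 2 + 2 * y * t + z) -> y ^+ 2 <= x * z.
Proof.
move=> x0 xyz; have [xE|xn0] := eqVneq x 0.
  have [->|y0] := eqVneq y 0; first by rewrite xE expr0n mul0r.
  have := xyz (- (z + 1) / (2 * y)).
  have -> : 2 * y * (- (z + 1) / (2 * y)) = - (z + 1) by field.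
  by rewrite xE; nra.
have {xyz} := xyz (- y / x).
have -> : x * (- y / x) ^+ 2 + 2 * y * (- y / x) + z = (x * z - y ^+ 2) / x.
  by field.
by rewrite pmulr_lge0 ?subr_ge0// invr_gt0 lt_neqAle eq_sym xn0.
Qed.

(** The quadratic form of [A] is non-negative at [u + t *: v] for every [t], so
   its discriminant is non-positive. *)
Lemma pos_CS A u v : symop A -> posop A ->
  '[A u, v] ^+ 2 <= '[A u, u] * '[A v, v].
Proof.
move=> sA pA; rewrite [leRHS]mulrC; apply: quad_discr => // t.
have := pA (u + t *: v); rewrite symopD// symopZ// !ipE.
by rewrite (ipC (A v)) -sA; lra.
Qed.

Lemma CS u v : '[u, v] ^+ 2 <= '[u] * '[v].
Proof.
by apply: (@pos_CS id) => // w; exact: ip_ge0.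
Qed.

Lemma pos_kernel A u : symop A -> posop A -> '[A u, u] = 0 -> A u = 0.
Proof.
move=> sA pA Au; apply: ip_inj => w; rewrite ip0l; apply/eqP.
rewrite -sqrf_eq0 eq_le sqr_ge0 andbT.
by have := pos_CS u w sA pA; rewrite Au mul0r.
Qed.

Definition hnorm u := Num.sqrt '[u].

Lemma hnorm_ge0 u : 0 <= hnorm u. Proof. exact: sqrtr_ge0. Qed.

Lemma sqr_hnorm u : hnorm u ^+ 2 = '[u].
Proof. by rewrite sqr_sqrtr ?ip_ge0. Qed.

Lemma CS_norm u v : `|'[u, v]| <= hnorm u * hnorm v.
Proof.
rewrite -ler_sqr ?nnegrE ?mulr_ge0 ?hnorm_ge0// real_normK ?num_real//.
by rewrite exprMn !sqr_hnorm CS.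
Qed.

Lemma ler_hnormD u v : hnorm (u + v) <= hnorm u + hnorm v.
Proof.
rewrite -ler_sqr ?nnegrE ?addr_ge0 ?hnorm_ge0//.
rewrite sqrrD !sqr_hnorm nsqD.
have := ler_norm '[u, v]; have := CS_norm u v.
by rewrite -mulr_natl; lra.
Qed.

Lemma hnormZ a u : hnorm (a *: u) = `|a| * hnorm u.
Proof. by rewrite /hnorm !ipE mulrA -expr2 sqrtrM ?sqr_ge0// sqrtr_sqr. Qed.

Lemma nsqD_le u v : '[u + v] <= 2 * '[u] + 2 * '[v].
Proof. by have := ip_ge0 (u - v); rewrite nsqB nsqD; lra. Qed.

Definition hlim s l := (fun n => '[s n - l]) @ \oo --> (0 : R).

Lemma squeeze0 (f g : nat -> R) :
  (forall n, `|f n| <= g n) -> g @ \oo --> (0 : R) -> f @ \oo --> (0 : R).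
Proof.
move=> fg g0; apply: norm_cvg0; apply: (squeeze_cvgr _ (cvg_cst 0) g0).
by near=> n; rewrite normr_ge0 fg.
Unshelve. all: by end_near. Qed.

Lemma cvgn_le_bound (f : nat -> R) a b :
  f @ \oo --> a -> (forall n, f n <= b) -> a <= b.
Proof. by move=> fa fb; apply: (cvgr_to_le fa); exact: nearW. Qed.

Lemma cvgn_ge_bound (f : nat -> R) a b :
  f @ \oo --> a -> (forall n, b <= f n) -> b <= a.
Proof. by move=> fa fb; apply: (cvgr_to_ge fa); exact: nearW. Qed.

Lemma hlimP s l : hlim s l <-> hnorm (s n - l) @[n --> \oo] --> (0 : R).
Proof.
split=> [sl|sl]; last first.
  have := cvgM sl sl; rewrite mulr0 /hlim => sl2.
  have -> : (fun n => '[s n - l]) =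
    (fun n => hnorm (s n - l)) \* (fun n => hnorm (s n - l)).
    by apply/funext => n /=; rewrite -sqr_hnorm expr2.
  exact: sl2.
have := @sqrt_continuous R 0; rewrite /continuous_at sqrtr0 => s0.
exact: cvg_comp _ _ sl s0.
Qed.

Lemma hlim_ip s (t : nat -> H) l (m : H) : hlim s l -> hlim t m ->
  (fun n => '[s n, t n]) @ \oo --> '[l, m].
Proof.
move=> /hlimP sl /hlimP tm; apply/subr_cvg0.
pose a n := hnorm (s n - l); pose b n := hnorm (t n - m).
apply: (@squeeze0 _ (fun n => a n * b n + a n * hnorm m + hnorm l * b n)).
  move=> n; have -> : '[s n, t n] - '[l, m] =
      '[s n - l, t n - m] + '[s n - l, m] + '[l, t n - m].
    by rewrite !ipE; ring.
  rewrite (le_trans (ler_normD _ _))// lerD ?CS_norm//.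
  by rewrite (le_trans (ler_normD _ _))// lerD ?CS_norm.
have -> : (0 : R) = 0 * 0 + 0 * hnorm m + hnorm l * 0 by ring.
by apply: cvgD; [apply: cvgD; apply: cvgM|apply: cvgM] => //; exact: cvg_cst.
Qed.

Lemma hlim_cst l : hlim (fun=> l) l.
Proof. by rewrite /hlim subrr ip0l; exact: cvg_cst. Qed.

Lemma hlim_ipl s l w : hlim s l -> (fun n => '[s n, w]) @ \oo --> '[l, w].
Proof. by move=> sl; exact: hlim_ip sl (hlim_cst w). Qed.

Lemma hlimD s (t : nat -> H) l (m : H) : hlim s l -> hlim t m ->
  hlim (fun n => s n + t n) (l + m).
Proof.
move=> sl tm; apply: (@squeeze0 _ (fun n => 2 * '[s n - l] + 2 * '[t n - m])).
  by move=> n; rewrite ger0_norm ?ip_ge0// opprD addrACA nsqD_le.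
have -> : (0 : R) = 2 * 0 + 2 * 0 by ring.
by apply: cvgD; apply: cvgM => //; exact: cvg_cst.
Qed.

Lemma hlimB s (t : nat -> H) l (m : H) : hlim s l -> hlim t m ->
  hlim (fun n => s n - t n) (l - m).
Proof.
move=> sl tm; apply: hlimD => //; rewrite /hlim.
by under eq_fun do rewrite -opprD nsqN.
Qed.

(** The bound is on distances, so [f] need not be known to be linear. *)
Lemma hlim_contract (H' : hilbert R) (f : H -> H') c s l :
  (forall u v, '[f u - f v] <= c * '[u - v]) -> hlim s l ->
  (fun n => '[f (s n) - f l]) @ \oo --> (0 : R).
Proof.
move=> fc sl; apply: (@squeeze0 _ (fun n => c * '[s n - l])).
  by move=> n; rewrite ger0_norm ?ip_ge0.
by have := cvgM (cvg_cst c) sl; rewrite mulr0 => csl; exact: csl.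
Qed.

Lemma hlim_cauchy s l : hlim s l -> forall e, 0 < e ->
  exists N, forall m n, (N <= m)%N -> (N <= n)%N -> '[s m - s n] <= e.
Proof.
move=> sl e e0.
have e4 : 0 < e / 4 by rewrite divr_gt0.
have /cvgr0_norm_le/(_ _ e4)[N _ NP] : '[s n - l] @[n --> \oo] --> (0 : R).
  exact: sl.
exists N => m n Nm Nn.
have {}NP k : (N <= k)%N -> '[s k - l] <= e / 4.
  by move=> Nk; have := NP _ Nk; rewrite /= ger0_norm ?ip_ge0.
have -> : s m - s n = (s m - l) + - (s n - l) by rewrite opprB addrA subrK.
rewrite (le_trans (nsqD_le _ _))// nsqN.
by have := NP _ Nm; have := NP _ Nn; lra.
Qed.

Lemma hlim_ex s :
  (forall e, 0 < e -> exists N, forall m n, (N <= n)%N -> (n <= m)%N ->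
    '[s m - s n] <= e) -> exists l, hlim s l.
Proof.
move=> sC; apply: ip_complete => e /sC[N NP]; exists N => m n Nm Nn.
have [mn|/ltnW nm] := leqP n m; first exact: NP.
by rewrite -nsqN opprB NP.
Qed.

Lemma hlim_dominated s (a : nat -> R) : cvgn a ->
  (forall m n, (n <= m)%N -> '[s m - s n] <= a m - a n) -> exists l, hlim s l.
Proof.
move=> /cvgrPdist_le ac sa; apply: hlim_ex => e e0.
have e2 : 0 < e / 2 by rewrite divr_gt0.
have [N _ NP] := ac _ e2; exists N => m n Nn nm.
rewrite (le_trans (sa _ _ nm))//.
have := NP _ Nn; have := NP _ (leq_trans Nn nm); rewrite /=.
by rewrite !ler_norml => /andP[? ?] /andP[? ?]; lra.
Qed.

End HilbertTheory.

Lemma hlimZ (R : realType) (H : hilbert R) a (s : nat -> H) l : hlim s l ->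
  hlim (fun n => a *: s n) (a *: l).
Proof.
move=> sl; apply: (@hlim_contract _ H H ( *:%R a) (a ^+ 2) _ _ _ sl) => u v.
by rewrite -scalerBr ipZl ipZr mulrA.
Qed.

(** * Square roots of bounded positive operators *)

Section SquareRoot.
Variables (R : realType) (H : hilbert R).
Implicit Types (u v w : H) (A B P Q S Z : H -> H).

(** Maps with an adjoint are the ones that can be tested for commutation with
   weak limits of operators; they are linear, and need not be symmetric: the
   complex structure of a complex Hilbert space is one of them. *)
Definition adjointable Z := exists Z', forall u v, '[Z u, v] = '[u, Z' v].

Lemma symop_adjointable A : symop A -> adjointable A.
Proof. by exists A. Qed.

Lemma adjointableD Z u v : adjointable Z -> Z (u + v) = Z u + Z v.
Proof. by move=> [Z' ZZ']; apply: ip_inj => w; rewrite ipDl !ZZ' ipDl. Qed.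

Lemma adjointableZ Z a u : adjointable Z -> Z (a *: u) = a *: Z u.
Proof. by move=> [Z' ZZ']; apply: ip_inj => w; rewrite ipZl !ZZ' ipZl. Qed.

(** [pos_CS] at [u] and [A u] bounds ['[A u] ^ 2] by ['[A u, u]] times
   ['[A (A u), A u] <= c * '[A u]]. *)
Lemma posop_bound A c u : symop A -> posop A ->
  (forall v, '[A v, v] <= c * '[v]) -> '[A u] <= c * '[A u, u].
Proof.
move=> sA pA Ac; have [/ip_eq0->|Aun0] := eqVneq '[A u] 0.
  by rewrite !ip0l mulr0.
have Au0 : 0 < '[A u] by rewrite lt_neqAle eq_sym Aun0 ip_ge0.
have := pos_CS u (A u) sA pA; rewrite expr2 => CSu.
rewrite -(ler_pM2r Au0) (le_trans CSu)//.
by rewrite mulrAC [leRHS]mulrC ler_wpM2l.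
Qed.

Lemma posop_contract A u : symop A -> posop A ->
  (forall v, '[A v, v] <= '[v]) -> '[A u] <= '[A u, u].
Proof.
move=> sA pA A1; have := @posop_bound A 1 u sA pA.
by rewrite mul1r; apply => v; rewrite mul1r.
Qed.

(** The polynomials in [B] with non-negative coefficients.  When [B] is positive
   they are positive operators, which avoids any discussion of the positivity of
   a product of commuting positive operators. *)
Inductive nnpoly B : (H -> H) -> Prop :=
| nnpoly_pow k : nnpoly B (iter k B)
| nnpoly_add P Q : nnpoly B P -> nnpoly B Q -> nnpoly B (fun u => P u + Q u)
| nnpoly_scale c P : 0 <= c -> nnpoly B P -> nnpoly B (fun u => c *: P u).

Lemma nnpoly_ext B P Q : nnpoly B P -> P =1 Q -> nnpoly B Q.
Proof. by move=> BP /funext <-. Qed.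

Lemma nnpoly_comm B P Z : adjointable Z -> (forall u, Z (B u) = B (Z u)) ->
  nnpoly B P -> forall u, Z (P u) = P (Z u).
Proof.
move=> aZ ZB; elim=> [k|P1 P2 _ IH1 _ IH2|c P1 _ _ IH] u.
- by elim: k => //= k IH; rewrite ZB IH.
- by rewrite adjointableD// IH1 IH2.
- by rewrite adjointableZ// IH.
Qed.

Lemma nnpoly_sym B P : symop B -> nnpoly B P -> symop P.
Proof.
move=> sB; elim=> [k|P1 P2 _ IH1 _ IH2|c P1 _ _ IH] u v.
- by elim: k u v => //= k IH u v; rewrite sB IH -iterSr.
- by rewrite ipDl ipDr IH1 IH2.
- by rewrite ipZl ipZr IH.
Qed.

(** Even powers are squares, and odd powers are conjugates of [B] by a power. *)
Lemma nnpoly_pos B P : symop B -> posop B -> nnpoly B P -> posop P.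
Proof.
move=> sB pB; elim=> [k|P1 P2 _ IH1 _ IH2|c P1 c0 _ IH] u.
- have sBk := nnpoly_sym sB (nnpoly_pow B k./2).
  rewrite -(odd_double_half k) -addnn; set j := k./2 in sBk *.
  case: odd; rewrite ?add1n ?add0n /= iterD; last by rewrite sBk ip_ge0.
  by rewrite -iterS iterSr sBk.
- by rewrite ipDl addr_ge0.
- by rewrite ipZl mulr_ge0.
Qed.

Lemma nnpoly_comp B P Q : symop B -> nnpoly B P -> nnpoly B Q ->
  nnpoly B (fun u => P (Q u)).
Proof.
move=> sB BP BQ; elim: BP => [k|P1 P2 _ IH1 _ IH2|c P1 c0 _ IH].
- elim: BQ => [l|Q1 Q2 _ IH1 _ IH2|c Q1 c0 _ IH].
  + by apply: nnpoly_ext (nnpoly_pow B (k + l)) _ => u; rewrite iterD.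
  + apply: nnpoly_ext (nnpoly_add IH1 IH2) _ => u.
    by rewrite (symopD _ _ (nnpoly_sym sB (nnpoly_pow B k))).
  + apply: nnpoly_ext (nnpoly_scale c0 IH) _ => u.
    by rewrite (symopZ _ _ (nnpoly_sym sB (nnpoly_pow B k))).
- exact: nnpoly_add.
- exact: nnpoly_scale.
Qed.

(** The limit [Y] of these iterates solves [Y = (B + Y ^ 2) / 2], that is,
   [(1 - Y) ^ 2 = 1 - B]. *)
Fixpoint sqrt_iter B n u : H :=
  if n is n'.+1 then 2^-1 *: (B u + sqrt_iter B n' (sqrt_iter B n' u)) else 0.

Section Iteration.
Variable B : H -> H.
Hypotheses (sB : symop B) (pB : posop B) (B1 : forall u, '[B u, u] <= '[u]).
Local Notation Y := (sqrt_iter B).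

Lemma sqrt_iter_nnpoly n : nnpoly B (Y n).
Proof.
elim: n => [|n IH].
  apply: nnpoly_ext (nnpoly_scale (lexx 0) (nnpoly_pow B 0)) _ => u.
  by rewrite scale0r.
apply: nnpoly_scale; first by rewrite invr_ge0.
by apply: nnpoly_add; [exact: (nnpoly_pow B 1)|exact: nnpoly_comp].
Qed.

Lemma sqrt_iter_sym n : symop (Y n).
Proof. exact/(nnpoly_sym sB)/sqrt_iter_nnpoly. Qed.

Lemma sqrt_iter_pos n : posop (Y n).
Proof. exact/(nnpoly_pos sB pB)/sqrt_iter_nnpoly. Qed.

(** With [D = Y k.+1 - Y k], the next increment [Y k.+2 - Y k.+1] is
   [(Y k.+1 D + D (Y k)) / 2], again a polynomial with non-negative
   coefficients. *)
Lemma sqrt_iter_incr m n : (n <= m)%N -> nnpoly B (fun u => Y m u - Y n u).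
Proof.
have YS k : nnpoly B (fun u => Y k.+1 u - Y k u).
  elim: k => [|k IH].
    apply: nnpoly_ext (sqrt_iter_nnpoly 1) _ => u.
    by rewrite [Y 0 u]/= subr0.
  have half0 : 0 <= (2^-1 : R) by rewrite invr_ge0.
  have Yk := sqrt_iter_nnpoly k; have Yk1 := sqrt_iter_nnpoly k.+1.
  apply: nnpoly_ext
    (nnpoly_scale half0 (nnpoly_add (nnpoly_comp sB Yk1 IH)
                                    (nnpoly_comp sB IH Yk))) _ => u.
  rewrite (symopB _ _ (@sqrt_iter_sym k.+1)) addrA subrK.
  rewrite [in RHS]/= -scalerBr -/(sqrt_iter B k.+1 _) [in RHS]opprD.
  by rewrite addrACA subrr add0r.
move=> /subnK <-; elim: (m - n)%N => [|k IH].
  apply: nnpoly_ext (nnpoly_scale (lexx 0) (nnpoly_pow B 0)) _ => u.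
  by rewrite add0n subrr scale0r.
apply: nnpoly_ext (nnpoly_add (YS (k + n)%N) IH) _ => u.
by rewrite addSn addrA subrK.
Qed.

Lemma sqrt_iter_le1 n u : '[Y n u, u] <= '[u].
Proof.
elim: n u => [|n IH] u; first by rewrite /= ip0l ip_ge0.
rewrite /= ipZl ipDl (@sqrt_iter_sym n (Y n u)).
have := posop_contract u (@sqrt_iter_sym n) (@sqrt_iter_pos n) IH.
by have := B1 u; have := IH u; lra.
Qed.

(** An increment [D] satisfies [0 <= D <= 1], so ['[D u] <= '[D u, u]], and the
   right-hand side is an increment of the bounded monotone sequence
   ['[Y n u, u]]. *)
Lemma sqrt_iter_lim u : exists l, hlim (fun n => Y n u) l.
Proof.
pose a n := '[Y n u, u].
have incr m n : (n <= m)%N -> posop (fun v => Y m v - Y n v).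
  by move=> nm; exact/(nnpoly_pos sB pB)/sqrt_iter_incr.
apply: (@hlim_dominated _ _ _ a).
  apply: nondecreasing_is_cvgn.
    by move=> n m nm; have := incr _ _ nm u; rewrite ipBl subr_ge0.
  by exists '[u] => _ [n _ <-]; exact: sqrt_iter_le1.
move=> m n nm; rewrite /a -ipBl.
apply: (@posop_contract (fun v => Y m v - Y n v)) => //.
- exact/(nnpoly_sym sB)/sqrt_iter_incr.
- exact: incr.
- move=> v; rewrite ipBl (le_trans _ (sqrt_iter_le1 m v))//.
  by rewrite lerBlDr lerDl sqrt_iter_pos.
Qed.

End Iteration.

Definition bicommutant A S := forall Z, adjointable Z ->
  (forall u, Z (A u) = A (Z u)) -> forall u, Z (S u) = S (Z u).

Lemma sqrt_contract A : symop A -> posop A -> (forall u, '[A u, u] <= '[u]) ->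
  exists S, [/\ symop S, posop S, forall u, S (S u) = A u & bicommutant A S].
Proof.
move=> sA pA A1; pose B u := u - A u.
have sB : symop B by move=> u v; rewrite /B ipBl ipBr sA.
have pB : posop B by move=> u; rewrite /B ipBl subr_ge0.
have B1 u : '[B u, u] <= '[u] by rewrite /B ipBl gerBl.
have [Y YP] := choice (sqrt_iter_lim sB pB B1).
have sY : symop Y.
  move=> u w; apply: (cvg_unique _ (hlim_ipl (w := w) (YP u))) => //.
  have -> : (fun n => '[sqrt_iter B n u, w]) = (fun n => '[u, sqrt_iter B n w]).
    by apply/funext => n; rewrite (sqrt_iter_sym sB).
  exact: hlim_ip (hlim_cst u) (YP w).
have YE u : Y u = 2^-1 *: (B u + Y (Y u)).
  apply: ip_inj => w.
  have YSl : '[sqrt_iter B n.+1 u, w] @[n --> \oo] --> '[Y u, w].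
    by have := hlim_ipl (w := w) (YP u); rewrite -(cvg_shiftS _).
  apply: (cvg_unique _ YSl) => //; rewrite ipZl ipDl sY.
  have -> : (fun n => '[sqrt_iter B n.+1 u, w]) =
      (fun n => 2^-1 * ('[B u, w] + '[sqrt_iter B n u, sqrt_iter B n w])).
    by apply/funext => n; rewrite /= ipZl ipDl (sqrt_iter_sym sB).
  apply: cvgM; first exact: cvg_cst.
  by apply: cvgD; [exact: cvg_cst|exact: hlim_ip].
exists (fun u => u - Y u); split.
- by move=> u v; rewrite ipBl ipBr sY.
- move=> u; rewrite ipBl subr_ge0.
  apply: (cvgn_le_bound (hlim_ipl (w := u) (YP u))) => n.
  exact: sqrt_iter_le1.
- move=> u; rewrite (symopB _ _ sY); apply: ip_inj => w.
  have := congr1 (fun v => '[v, w]) (YE u).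
  by rewrite /= /B !ipE; lra.
- move=> Z aZ ZA u; rewrite adjointableD// -scaleN1r adjointableZ// scaleN1r.
  congr (_ - _); have [Z' ZZ'] := aZ; apply: ip_inj => w.
  have ZB v : Z (B v) = B (Z v).
    by rewrite /B adjointableD// -scaleN1r adjointableZ// scaleN1r ZA.
  rewrite ZZ'; apply: (cvg_unique _ (hlim_ipl (w := Z' w) (YP u))) => //.
  have -> : (fun n => '[sqrt_iter B n u, Z' w]) =
      (fun n => '[sqrt_iter B n (Z u), w]).
    apply/funext => n; rewrite -ZZ'.
    by rewrite (nnpoly_comm aZ ZB (sqrt_iter_nnpoly sB n)).
  exact: hlim_ipl.
Qed.

(** Membership of the square root in the bicommutant is what makes it unique
   and, in a complex space, complex linear. *)
Theorem sqrt_op A c : symop A -> posop A -> (forall u, '[A u, u] <= c * '[u]) ->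
  exists S, [/\ symop S, posop S, forall u, S (S u) = A u & bicommutant A S].
Proof.
move=> sA pA Ac; pose d := `|c| + 1.
have d0 : 0 < d by rewrite ltr_wpDl.
have dn0 : d != 0 by rewrite gt_eqF.
have [||u|S [sS pS SS cS]] := @sqrt_contract (fun u => d^-1 *: A u).
- by move=> u v; rewrite ipZl ipZr sA.
- by move=> u; rewrite ipZl mulr_ge0// invr_ge0 ltW.
- rewrite ipZl mulrC ler_pdivrMr// (le_trans (Ac u))// mulrC.
  rewrite ler_wpM2l ?ip_ge0// (le_trans (ler_norm c))// lerDl//.
exists (fun u => Num.sqrt d *: S u); split.
- by move=> u v; rewrite ipZl ipZr sS.
- by move=> u; rewrite ipZl mulr_ge0// sqrtr_ge0.
- move=> u; rewrite (symopZ _ _ sS) scalerA SS scalerA -expr2 sqr_sqrtr ?ltW//.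
  by rewrite divff// scale1r.
- move=> Z aZ ZA u; rewrite adjointableZ// cS// => v.
  by rewrite adjointableZ// ZA.
Qed.

(** By commutation [(M + N) (M - N) = 0], so the quadratic forms of [M] and [N]
   both vanish on the range of [M - N], and [(M - N) ^ 2 = 0]. *)
Lemma sqrt_op_unique_comm M N : symop M -> posop M -> symop N -> posop N ->
  (forall u, M (M u) = N (N u)) -> (forall u, M (N u) = N (M u)) -> M =1 N.
Proof.
move=> sM pM sN pN MN cMN u; apply/eqP; rewrite -subr_eq0; apply/eqP.
set D := fun v => M v - N v; rewrite -/(D u).
have MNDD v : '[M (D v), D v] + '[N (D v), D v] = 0.
  rewrite -ipDl (_ : _ + _ = 0) ?ip0l//.
  by rewrite /D (symopB _ _ sM) (symopB _ _ sN) MN cMN addrA subrK subrr.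
have MD v : M (D v) = 0.
  apply: pos_kernel => //.
  by have := MNDD v; have := pM (D v); have := pN (D v); lra.
have ND v : N (D v) = 0.
  apply: pos_kernel => //.
  by have := MNDD v; have := pM (D v); have := pN (D v); lra.
by apply: ip_eq0; rewrite {1}/D ipBl sM MD sN ND !ip0r subrr.
Qed.

(** [M] and [N] commute with their common square, hence with its square root
   [S] built above, so each of them is equal to [S]. *)
Theorem sqrt_op_unique M N c : symop M -> posop M -> symop N -> posop N ->
  (forall u, '[M u] <= c * '[u]) -> (forall u, M (M u) = N (N u)) -> M =1 N.
Proof.
move=> sM pM sN pN Mc MN.
have [|||S [sS pS SS cS]] := @sqrt_op (fun u => M (M u)) c.
- by move=> u v; rewrite !sM.
- by move=> u; rewrite sM ip_ge0.
- by move=> u; rewrite sM.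
have MS : M =1 S.
  apply: sqrt_op_unique_comm => // u; apply: cS => //.
  exact: symop_adjointable.
have NS : N =1 S.
  apply: sqrt_op_unique_comm => // u; first by rewrite SS -MN.
  apply: cS; first exact: symop_adjointable.
  by move=> v; rewrite !MN.
by move=> u; rewrite MS NS.
Qed.

End SquareRoot.

(** * Orthogonal complements *)

Section Projection.
Variables (R : realType) (H : hilbert R).
Implicit Types (u v w : H) (W : H -> Prop).

Definition lin_subspace W := W 0 /\ forall a u v, W u -> W v -> W (a *: u + v).

Definition perp W u := forall w, W w -> '[u, w] = 0.

Definition adherent W u := forall e, 0 < e -> exists2 w, W w & '[u - w] <= e.

(** A minimising sequence for the distance of [u] to [W] is Cauchy by the
   parallelogram identity, and at its limit [l] the distance of [u - l] to a line
   spanned by a vector of [W] is minimal at the origin. *)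
Lemma ortho_decomposition W u : lin_subspace W ->
  exists p, perp W p /\ adherent W (u - p).
Proof.
move=> [W0 WD]; pose E := [set '[u - w] | w in W].
have E0 : E !=set0 by exists '[u - 0]; exists 0.
have lbE : has_lbound E by exists 0 => _ [w _ <-]; exact: ip_ge0.
pose d := inf E.
have dle w : W w -> d <= '[u - w] by move=> Ww; apply: ge_inf => //; exists w.
have /choice[s sP] n : exists w, W w /\ '[u - w] <= d + n.+1%:R^-1.
  have n0 : 0 < (n.+1%:R^-1 : R) by rewrite invr_gt0.
  have [|_ [w Ww <-] /ltW] := @inf_adherent _ E _ n0; first by split.
  by exists w.
have half x y : W x -> W y -> W (2^-1 *: (x + y)).
  move=> Wx Wy; rewrite -[_ *: _]addr0; apply: (WD) => //.
  by rewrite -[x]scale1r; apply: WD.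
have par x y : '[x - y] =
    2 * '[u - x] + 2 * '[u - y] - 4 * '[u - 2^-1 *: (x + y)].
  by rewrite !ipE (ipC y x) (ipC x u) (ipC y u); field.
have [l sl] : exists l, hlim s l.
  apply: hlim_ex => e e0.
  have [N Ne] : exists N, 4 * N.+1%:R^-1 <= e.
    exists (Num.trunc (4 / e)).
    rewrite -ler_pdivlMl// -lef_pV2 ?posrE// ?mulr_gt0//.
      by rewrite invrK invrM ?unitfE ?gt_eqF// mulrC invrK ltW// truncnS_gt.
  exists N => m n Nn nm; rewrite par.
  have [Wm sm] := sP m; have [Wn sn] := sP n.
  have := dle _ (half _ _ Wm Wn).
  have inv_le k : (N <= k)%N -> (k.+1%:R^-1 : R) <= N.+1%:R^-1.
    by move=> Nk; rewrite lef_pV2 ?posrE// ler_nat.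
  have := inv_le _ Nn; have := inv_le _ (leq_trans Nn nm).
  move: Ne sm sn; move: (m.+1%:R^-1) (n.+1%:R^-1) (N.+1%:R^-1) => x y z.
  by lra.
have usl v : hlim (fun n => u - s n - v) (u - l - v).
  by do 2![apply: hlimB; try exact: hlim_cst].
have ul : '[u - l] <= d.
  have us : '[u - s n - 0] - harmonic n @[n --> \oo] --> '[u - l - 0] - 0.
    by apply: cvgB; [exact: hlim_ip|exact: cvg_harmonic].
  rewrite !subr0 in us; apply: (cvgn_le_bound us) => n.
  by rewrite subr0 lerBlDr; have [] := sP n.
exists (u - l); split; last first.
  move=> e e0; have /cvgr0_norm_le/(_ _ e0)[N _ /(_ N (leqnn N))/= Ne] :
    '[s n - l] @[n --> \oo] --> (0 : R) by exact: sl.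
  exists (s N); first by have [] := sP N.
  by rewrite subKr -nsqN opprB (le_trans (ler_norm _)).
move=> w Ww.
have dt t : d <= '[u - l - t *: w].
  apply: (cvgn_ge_bound (hlim_ip (usl _) (usl _))) => n.
  rewrite -addrA -opprD; apply: dle; rewrite addrC; apply: WD => //.
  by have [] := sP n.
have := @quad_discr R '[w] (- '[u - l, w]) 0 (ip_ge0 w).
rewrite mulr0 sqrrN => h; apply/eqP; rewrite -sqrf_eq0 eq_le sqr_ge0 andbT.
apply: h => t; have := dt t; rewrite nsqB ipZl !ipZr.
by lra.
Qed.

Lemma adherent_ip0 W u v : perp W v -> adherent W u -> '[u, v] = 0.
Proof.
move=> Wv uW; apply/eqP; rewrite -sqrf_eq0 eq_le sqr_ge0 andbT.
apply/ler_addgt0Pl => e e0; rewrite addr0.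
have v1 : 0 < '[v] + 1 by rewrite ltr_wpDl ?ip_ge0.
have [w Ww uw] := uW (e / ('[v] + 1)) (divr_gt0 e0 v1).
have -> : '[u, v] = '[u - w, v] by rewrite ipBl [X in _ - X]ipC Wv// subr0.
rewrite (le_trans (CS _ _))//.
rewrite (le_trans (ler_wpM2r (ip_ge0 v) uw))// mulrAC ler_pdivrMr//.
by rewrite (ler_wpM2l (ltW e0))// lerDl.
Qed.

Lemma adherent_hlim W u : adherent W u ->
  exists2 s : nat -> H, forall n, W (s n) & hlim s u.
Proof.
move=> uW; have /choice[s sP] n : exists w, W w /\ '[u - w] <= n.+1%:R^-1.
  by have [|w Ww uw] := uW n.+1%:R^-1; [rewrite invr_gt0|exists w].
exists s; first by move=> n; have [] := sP n.
apply: (@squeeze0 _ _ harmonic); last exact: cvg_harmonic.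
by move=> n; rewrite ger0_norm ?ip_ge0// -nsqN opprB; have [] := sP n.
Qed.

(** [P] is the orthogonal projection onto the orthogonal complement of [W], and
   [u - P u] is the projection of [u] onto the closure of [W]. *)
Definition ortho_proj W (P : H -> H) :=
  forall u, perp W (P u) /\ adherent W (u - P u).

Lemma ortho_proj_ex W : lin_subspace W -> exists P, ortho_proj W P.
Proof.
move=> sW; have [P WP] := choice (fun u => ortho_decomposition u sW).
by exists P.
Qed.

Section OrthoProj.
Variables (W : H -> Prop) (P : H -> H).
Hypothesis WP : ortho_proj W P.

Lemma ortho_proj_ip u v : perp W v -> '[P u, v] = '[u, v].
Proof.
move=> Wv; apply/eqP; rewrite eq_sym -subr_eq0 -ipBl; apply/eqP.
by apply: adherent_ip0 Wv _; have [] := WP u.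
Qed.

Lemma ortho_proj_id u : perp W u -> P u = u.
Proof.
move=> Wu; have [WPu _] := WP u.
apply/eqP; rewrite -subr_eq0; apply/eqP/ip_eq0.
have Wd : perp W (P u - u) by move=> w Ww; rewrite ipBl WPu// Wu// subrr.
by rewrite {1}ipBl ortho_proj_ip// subrr.
Qed.

Lemma ortho_proj_sym : symop P.
Proof.
move=> u v; have [Wu _] := WP u; have [Wv _] := WP v.
by rewrite -(ortho_proj_ip u Wv) ipC -(ortho_proj_ip v Wu) ipC.
Qed.

Lemma ortho_proj_nsq u : '[P u] = '[P u, u].
Proof. by have [Wu _] := WP u; rewrite ipC -(ortho_proj_ip u Wu). Qed.

Lemma ortho_proj_le u : '[P u] <= '[u].
Proof.
have := ip_ge0 (u - P u); rewrite nsqB (ipC u) -ortho_proj_nsq.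
by lra.
Qed.

(** A skew-adjoint map that preserves [W] preserves its complement. *)
Lemma ortho_proj_comm Z : (forall u v, '[Z u, v] = - '[u, Z v]) ->
  (forall w, W w -> W (Z w)) -> forall u, P (Z u) = Z (P u).
Proof.
move=> ZN WZ u; have ZW v : perp W v -> perp W (Z v).
  by move=> Wv w Ww; rewrite ZN Wv ?oppr0//; exact: WZ.
set d := P (Z u) - Z (P u); apply/eqP; rewrite -subr_eq0 -/d; apply/eqP/ip_eq0.
have [Wu _] := WP u; have [WZu _] := WP (Z u).
have Wd : perp W d by move=> w Ww; rewrite ipBl WZu// (ZW _ Wu)// subrr.
rewrite {1}/d ipBl ortho_proj_ip// !ZN ortho_proj_ip; last exact: ZW.
by rewrite opprK addNr.
Qed.

End OrthoProj.

Lemma dense_lin_subspace W u :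
  lin_subspace W -> (forall v, perp W v -> v = 0) -> adherent W u.
Proof.
move=> sW W0; have [p [Wp]] := ortho_decomposition u sW.
by rewrite (W0 _ Wp) subr0.
Qed.
End Projection.

(** * Product spaces and uniform boundedness *)

Section Product.
Variables (R : realType) (H G : hilbert R).
Implicit Types u v w : (H * G)%type.

Definition prod_ip u v : R := '[u.1, v.1] + '[u.2, v.2].

Fact prod_ipC u v : prod_ip u v = prod_ip v u.
Proof. by rewrite /prod_ip ipC (ipC u.2). Qed.

Fact prod_ipDl u v w : prod_ip (u + v) w = prod_ip u w + prod_ip v w.
Proof. by rewrite /prod_ip !ipDl addrACA. Qed.

Fact prod_ipZl a u w : prod_ip (a *: u) w = a * prod_ip u w.
Proof. by rewrite /prod_ip !ipZl mulrDr. Qed.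

Fact prod_ip_ge0 u : 0 <= prod_ip u u.
Proof. by rewrite addr_ge0 ?ip_ge0. Qed.

Fact prod_ip_eq0 u : prod_ip u u = 0 -> u = 0.
Proof.
case: u => x y; rewrite /prod_ip /= => xy.
have := ip_ge0 x; have := ip_ge0 y => y0 x0.
have /ip_eq0-> : '[x] = 0 by lra.
by have /ip_eq0-> : '[y] = 0 by lra.
Qed.

Fact prod_ip_complete (s : nat -> (H * G)%type) :
  (forall e, 0 < e -> exists N, forall m n, (N <= m)%N -> (N <= n)%N ->
     prod_ip (s m - s n) (s m - s n) <= e) ->
  exists l, (fun n => prod_ip (s n - l) (s n - l)) @ \oo --> (0 : R).
Proof.
move=> sC.
have [|l1 s1] := @hlim_ex _ H (fun n => (s n).1).
  move=> e /sC[N NP]; exists N => m n Nn nm.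
  by rewrite (le_trans _ (NP m n _ _)) ?lerDl ?ip_ge0// (leq_trans Nn).
have [|l2 s2] := @hlim_ex _ G (fun n => (s n).2).
  move=> e /sC[N NP]; exists N => m n Nn nm.
  by rewrite (le_trans _ (NP m n _ _)) ?lerDr ?ip_ge0// (leq_trans Nn).
by exists (l1, l2); have := cvgD s1 s2; rewrite addr0 => s12; exact: s12.
Qed.

Definition prod_hilbert : hilbert R := @Hilbert R (H * G)%type prod_ip
  prod_ipC prod_ipDl prod_ipZl prod_ip_ge0 prod_ip_eq0 prod_ip_complete.

End Product.

Section UniformBoundedness.
Variables (R : realType) (H : hilbert R).
Implicit Types (x v w : H).

(** If the bound fails there are indices [i n] such that the norm of [w (i n)]
   exceeds [n.+1 * 3 ^ n] times that of [f (i n)]; let [xi n] be the unit vector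
   along [w (i n)].  By Sokal's form of the gliding hump argument, the point
   [x n] is moved by [3 ^- n] along [xi n], in the direction that gives
   [|'[x n.+1, xi n]| >= 3 ^- n]; the later moves have total length
   [3 ^- n / 2], so the limit [l] satisfies [|'[l, xi n]| >= 3 ^- n / 2] for
   every [n].  This is incompatible with ['[w i, l] = '[f i, v]]. *)
Lemma uniform_bound (I : Type) (f w : I -> H) :
  (forall x, exists v, forall i, '[w i, x] = '[f i, v]) ->
  exists2 c, 0 < c & forall i, '[w i] <= c * '[f i].
Proof.
move=> adj; apply: contrapT => unb.
pose t n : R := 3 ^- n.
have t0 n : 0 < t n by rewrite invr_gt0 exprn_gt0.
have tS n : t n.+1 = t n / 3 by rewrite /t exprS invfM mulrC.
have /choice[i iP] n : exists i, (n.+1%:R * 3 ^+ n) ^+ 2 * '[f i] < '[w i].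
  apply: contrapT => nw; apply: unb; exists ((n.+1%:R * 3 ^+ n) ^+ 2).
    by rewrite exprn_gt0// mulr_gt0// exprn_gt0.
  by move=> i; rewrite leNgt; apply/negP => wi; apply: nw; exists i.
have w0 n : 0 < hnorm (w (i n)).
  by rewrite sqrtr_gt0 (le_lt_trans _ (iP n))// mulr_ge0 ?ip_ge0 ?sqr_ge0.
pose xi n := (hnorm (w (i n)))^-1 *: w (i n).
have xi1 n : hnorm (xi n) = 1.
  by rewrite hnormZ ger0_norm ?invr_ge0 ?hnorm_ge0// mulVf// gt_eqF.
pose fix x n : H := if n is m.+1 then
  x m + (if 0 <= '[x m, xi m] then t m else - t m) *: xi m else 0.
have xE n : x n.+1 = x n + (if 0 <= '[x n, xi n] then t n else - t n) *: xi n.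
  by [].
have xS n : t n <= `|'[x n.+1, xi n]|.
  have xi11 : '[xi n] = 1 by rewrite -sqr_hnorm xi1 expr1n.
  rewrite xE ipDl ipZl xi11 mulr1; have := t0 n; case: ifPn => [x0 tn|].
    by rewrite ger0_norm; lra.
  by rewrite -ltNge => x0 tn; rewrite ler0_norm; lra.
have xD n k : hnorm (x (k + n)%N - x n) <= 3 / 2 * (t n - t (k + n)%N).
  elim: k => [|k IH]; first by rewrite add0n !subrr mulr0 /hnorm ip0l sqrtr0.
  rewrite addSn xE addrAC (le_trans (ler_hnormD _ _))// hnormZ xi1 mulr1 tS.
  rewrite (_ : `|_| = t (k + n)%N); last first.
    by case: ifP; rewrite ?normrN gtr0_norm.
  by move: IH; lra.
have tcvg : t @ \oo --> (0 : R).
  have /cvg_expr : `|3^-1 : R| < 1 by rewrite ger0_norm; lra.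
  suff -> : t = GRing.exp (3^-1) by [].
  by apply/funext => n; rewrite exprVn.
have t1 n : t n <= 1 by rewrite invf_le1 ?exprn_gt0// exprn_ege1// ler1n.
move: xE => _; clearbody x.
have [l xl] : exists l, hlim x l.
  apply: (@hlim_dominated _ _ _ (fun n => - (9 / 4 * t n))).
    apply: is_cvgN; apply: is_cvgM; first exact: is_cvg_cst.
    by apply/cvg_ex; exists 0.
  move=> m n nm; rewrite -sqr_hnorm.
  have := xD n (m - n)%N; rewrite subnK//.
  have := hnorm_ge0 (x m - x n); have := t0 m; have := t1 n.
  by move: (hnorm _) (t m) (t n) => y a b; nra.
have [v vP] := adj l.
have vn n : n.+1%:R <= 2 * hnorm v.
  have tl : t n / 2 <= `|'[l, xi n]|.
    have xl' : '[x (k + n.+1)%N, xi n] @[k --> \oo] --> '[l, xi n].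
      by have := hlim_ipl (w := xi n) xl; rewrite -(cvg_shiftn n.+1).
    apply: (cvgn_ge_bound (cvg_norm xl')) => k.
    have := xS n; have := CS_norm (x n.+1 - x (k + n.+1)%N) (xi n).
    rewrite xi1 mulr1 ipBl.
    have := xD n.+1 k; rewrite -[hnorm (_ - x n.+1)]/(Num.sqrt _) -nsqN opprB.
    rewrite -/(hnorm _) tS; have := t0 (k + n.+1)%N.
    have := ler_normD ('[x n.+1, xi n] - '[x (k + n.+1)%N, xi n])
      '[x (k + n.+1)%N, xi n].
    by rewrite subrK; lra.
  have wn := w0 n; move: tl.
  rewrite /xi ipZr ipC vP normrM ger0_norm ?invr_ge0 ?hnorm_ge0//.
  rewrite [leRHS]mulrC ler_pdivlMr// => tl.
  have fw : (n.+1%:R * 3 ^+ n) * hnorm (f (i n)) <= hnorm (w (i n)).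
    have p0 : 0 <= (n.+1%:R * 3 ^+ n : R) by rewrite mulr_ge0// exprn_ge0.
    rewrite -ler_sqr ?nnegrE ?mulr_ge0 ?hnorm_ge0//.
    by rewrite exprMn !sqr_hnorm ltW.
  have fv := le_trans tl (CS_norm (f (i n)) v).
  have p3 : 0 < 3 ^+ n :> R by rewrite exprn_gt0.
  have {}fv : hnorm (w (i n)) <= 3 ^+ n * hnorm (f (i n)) * (2 * hnorm v).
    rewrite -(ler_pM2l (t0 n)) !mulrA mulVf ?gt_eqF// mul1r.
    by move: fv; lra.
  have f0 : 0 < 3 ^+ n * hnorm (f (i n)).
    rewrite mulr_gt0// lt_neqAle hnorm_ge0 andbT eq_sym.
    apply: contraTneq fv => ->; rewrite mulr0 mul0r -ltNge.
    exact: wn.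
  rewrite -(ler_pM2l f0) (le_trans _ fv)// (le_trans _ fw)//.
  by rewrite mulrC mulrA.
have := vn (Num.trunc (2 * hnorm v)).
by rewrite leNgt truncnS_gt.
Qed.

End UniformBoundedness.

(** * Unordered sums and the Hilbert space of square-summable families *)

#[local] Existing Instance totally_filter.

Lemma partial_sumE (V : zmodType) (Y : choiceType) (f : Y -> V) (A : {fset Y}) :
  partial_sum f A = \sum_(y <- A) f y.
Proof. by rewrite /partial_sum big_seq_fsetE. Qed.

Lemma has_sum_unique (F : numFieldType) (Y : choiceType) (f : Y -> F) s t :
  has_sum f s -> has_sum f t -> s = t.
Proof. by move=> fs ft; apply: (cvg_unique _ fs ft). Qed.

Section RealSums.
Variables (R : realType) (Y : choiceType).
Implicit Types (f g : Y -> R) (A B : {fset Y}).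

Lemma partial_sum_le f A B : (forall y, 0 <= f y) -> (A `<=` B)%fset ->
  partial_sum f A <= partial_sum f B.
Proof.
move=> f0 AB; rewrite !partial_sumE (big_fsetID _ (mem A) B)/=.
have -> : [fset x in B | x \in A]%fset = A.
  apply/fsetP => x; rewrite !inE/= andbC; case xA : (x \in A) => //=.
  exact: (fsubsetP AB).
by rewrite lerDl sumr_ge0.
Qed.

Lemma has_sumD f g s t : has_sum f s -> has_sum g t ->
  has_sum (fun y => f y + g y) (s + t).
Proof.
move=> fs gt; rewrite /has_sum.
have -> : partial_sum (fun y => f y + g y) =
    (fun A => partial_sum f A + partial_sum g A).
  by apply/funext => A; rewrite /= /partial_sum big_split.
exact: (cvgD fs gt).
Qed.

Lemma has_sumZ a f s : has_sum f s -> has_sum (fun y => a * f y) (a * s).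
Proof.
move=> fs; rewrite /has_sum.
have -> : partial_sum (fun y => a * f y) = (fun A => a * partial_sum f A).
  by apply/funext => A; rewrite /= /partial_sum mulr_sumr.
by apply: cvgM => //; exact: cvg_cst.
Qed.

Lemma has_sum_ge f s A : (forall y, 0 <= f y) -> has_sum f s ->
  partial_sum f A <= s.
Proof.
move=> f0 fs; apply: (cvgr_to_ge fs); exists A => // B AB.
exact: partial_sum_le.
Qed.

Lemma has_sum_ex f M :
  (forall y, 0 <= f y) -> (forall A, partial_sum f A <= M) ->
  exists2 s, has_sum f s & s <= M.
Proof.
move=> f0 fM; pose E := range (partial_sum f).
have E0 : E !=set0 by exists (partial_sum f fset0); exists fset0.
have ubE : ubound E M by move=> _ [A _ <-]; exact: fM.
have supE : has_sup E by split => //; exists M.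
exists (sup E); last exact: ge_sup.
apply/cvgrPdist_le => e e0.
have [_ [A _ <-] Ae] := sup_adherent e0 supE.
exists A => // B AB; rewrite /= ger0_norm.
  by have := partial_sum_le f0 AB; lra.
by rewrite subr_ge0; apply: sup_upper_bound => //; exists B.
Qed.

End RealSums.

Section L2.
Variables (R : realType) (Y : choiceType).

Definition l2_bounded (u : Y -> R) M :=
  forall A : {fset Y}, partial_sum (fun y => u y ^+ 2) A <= M.

Definition l2_pred : {pred Y -> R^o} :=
  [pred u | `[< exists M, l2_bounded u M >]].

Fact l2_submod : submod_closed l2_pred.
Proof.
split.
  apply/asboolP; exists 0 => A.
  by rewrite partial_sumE big1// => y _; rewrite expr0n.
move=> a u v /asboolP[M uM] /asboolP[N vN]; apply/asboolP.
exists (2 * a ^+ 2 * M + 2 * N) => A.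
have := uM A; have := vN A; rewrite !partial_sumE => vNA uMA.
apply: (@le_trans _ _ (\sum_(y <- A) (2 * a ^+ 2 * u y ^+ 2 + 2 * v y ^+ 2))).
  apply: ler_sum => y _; rewrite -[(_ + _) y]/(a * u y + v y).
  by have := sqr_ge0 (a * u y - v y); rewrite !expr2; lra.
rewrite big_split/= -!mulr_sumr lerD ?ler_wpM2l//.
by rewrite mulr_ge0 ?sqr_ge0.
Qed.

HB.instance Definition _ :=
  GRing.isSubmodClosed.Build R (Y -> R^o) l2_pred l2_submod.

Record l2 := L2 { l2_fun : Y -> R^o; _ : l2_fun \in l2_pred }.

HB.instance Definition _ := [isSub for l2_fun].
HB.instance Definition _ := [Choice of l2 by <:].
HB.instance Definition _ := [SubChoice_isSubLmodule of l2 by <:].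

Definition l2_coord (u : l2) (y : Y) : R := l2_fun u y.
Coercion l2_coord : l2 >-> Funclass.

Lemma l2P (u : l2) : exists M, l2_bounded u M.
Proof. by apply/asboolP; case: u. Qed.

Lemma l2DE (u v : l2) y : (u + v) y = u y + v y. Proof. by []. Qed.
Lemma l2NE (u : l2) y : (- u) y = - u y. Proof. by []. Qed.
Lemma l2ZE a (u : l2) y : (a *: u) y = a * u y. Proof. by []. Qed.

Lemma l2_eq (u v : l2) : (forall y, u y = v y) -> u = v.
Proof. by move=> uv; apply/val_inj/funext. Qed.

(** By polarization this reduces to the sums of squares of [u + v] and
   [u - v]. *)
Lemma has_sum_l2 (u v : l2) : exists s, has_sum (fun y => u y * v y) s.
Proof.
have sq (w : l2) : exists s, has_sum (fun y => w y ^+ 2) s.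
  have [M wM] := l2P w.
  by have [|s ws _] := has_sum_ex _ wM; [move=> y; exact: sqr_ge0|exists s].
have [s us] := sq (u + v); have [t vt] := sq (u - v).
exists (4^-1 * (s + (-1) * t)).
have := has_sumZ (a := 4^-1) (has_sumD us (has_sumZ (a := -1) vt)).
congr (has_sum _ _); apply/funext => y; rewrite l2DE l2DE l2NE.
by field.
Qed.

Definition l2_ip (u v : l2) : R :=
  xget 0 [set s | has_sum (fun y => u y * v y) s].

Lemma l2_ipP (u v : l2) : has_sum (fun y => u y * v y) (l2_ip u v).
Proof. exact: (xgetPex 0 (has_sum_l2 u v)). Qed.

Arguments l2_ipP : clear implicits.

Fact l2_ipC u v : l2_ip u v = l2_ip v u.
Proof.
apply: has_sum_unique (l2_ipP u v) _.
by under eq_fun do rewrite mulrC; exact: l2_ipP.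
Qed.

Fact l2_ipDl u v w : l2_ip (u + v) w = l2_ip u w + l2_ip v w.
Proof.
apply: has_sum_unique (l2_ipP _ _) _.
under eq_fun do rewrite l2DE mulrDl.
by apply: has_sumD; exact: l2_ipP.
Qed.

Fact l2_ipZl a u w : l2_ip (a *: u) w = a * l2_ip u w.
Proof.
apply: has_sum_unique (l2_ipP _ _) _.
under eq_fun do rewrite l2ZE -mulrA.
by apply: has_sumZ; exact: l2_ipP.
Qed.

Lemma l2_nsqP (u : l2) : has_sum (fun y => u y ^+ 2) (l2_ip u u).
Proof. by have := l2_ipP u u; under eq_fun do rewrite -expr2. Qed.

Arguments l2_nsqP : clear implicits.

Lemma l2_nsq_ge (u : l2) A : partial_sum (fun y => u y ^+ 2) A <= l2_ip u u.
Proof. by apply: has_sum_ge (l2_nsqP u) => y; exact: sqr_ge0. Qed.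

Lemma l2_nsq_le (u : l2) M : l2_bounded u M -> l2_ip u u <= M.
Proof.
move=> uM; have [|s us sM] := has_sum_ex _ uM; first by move=> y; exact: sqr_ge0.
by rewrite (has_sum_unique (l2_nsqP u) us).
Qed.

Lemma l2_coord_le (u : l2) y : u y ^+ 2 <= l2_ip u u.
Proof.
by have := l2_nsq_ge u [fset y]%fset; rewrite partial_sumE big_seq_fset1.
Qed.

Fact l2_ip_ge0 u : 0 <= l2_ip u u.
Proof. by have := l2_nsq_ge u fset0; rewrite partial_sumE big_seq_fset0. Qed.

Fact l2_ip_eq0 u : l2_ip u u = 0 -> u = 0.
Proof.
move=> u0; apply: l2_eq => y; apply/eqP; rewrite -sqrf_eq0 eq_le sqr_ge0 andbT.
by rewrite -u0 l2_coord_le.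
Qed.

(** A Cauchy sequence converges pointwise; on each finite set the bound on
   [s n - s m] passes to the limit in [m], and the result is uniform in the
   finite set. *)
Fact l2_complete (s : nat -> l2) :
  (forall e, 0 < e -> exists N, forall m n, (N <= m)%N -> (N <= n)%N ->
     l2_ip (s m - s n) (s m - s n) <= e) ->
  exists l, (fun n => l2_ip (s n - l) (s n - l)) @ \oo --> (0 : R).
Proof.
move=> sC.
have /choice[u uP] y : exists l : R, s n y @[n --> \oo] --> l.
  apply/cvg_ex/cauchy_cvgP/cauchy_exP => e e0.
  have e2 : 0 < e ^+ 2 / 2 by rewrite divr_gt0// exprn_gt0.
  have [N NP] := sC _ e2; exists (s N y); exists N => // n /= Nn.
  have := NP N n (leqnn N) Nn.
  have := l2_coord_le (s N - s n) y; rewrite l2DE l2NE => c1 c2.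
  rewrite /ball/= -ltr_sqr ?nnegrE ?(ltW e0)// real_normK ?num_real//.
  by move: e2; lra.
have tail e : 0 < e -> exists N, forall n, (N <= n)%N ->
    l2_bounded (fun y => s n y - u y) e.
  move=> /sC[N NP]; exists N => n Nn A.
  have sA : partial_sum (fun y => (s n y - s m y) ^+ 2) A @[m --> \oo] -->
      partial_sum (fun y => (s n y - u y) ^+ 2) A.
    rewrite partial_sumE; under eq_fun do rewrite partial_sumE.
    apply: cvg_big; first exact: add_continuous.
    by move=> y _; apply: cvgM; apply: cvgB => //; exact: cvg_cst.
  apply: (cvgr_to_le sA).
  exists N => // m Nm.
  exact: le_trans (l2_nsq_ge (s n - s m) A) (NP _ _ Nn Nm).
have [N /(_ _ (leqnn N)) Nb] := tail 1 ltr01.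
have du : (fun y => s N y - u y) \in l2_pred by apply/asboolP; exists 1.
have uE : (fun y => u y) = s N - L2 du :> (Y -> R).
  by apply/funext => y; rewrite l2DE l2NE subKr.
exists (s N - L2 du); apply/cvgrPdist_le => e e0.
have [M MP] := tail _ e0; exists M => // n Mn.
rewrite sub0r normrN ger0_norm ?l2_ip_ge0//; apply: l2_nsq_le => A.
rewrite (le_trans _ (MP _ Mn A))// le_eqVlt; apply/orP; left; apply/eqP.
by congr partial_sum; apply/funext => y; rewrite l2DE l2NE -uE.
Qed.

Definition l2_hilbert : hilbert R := @Hilbert R l2 l2_ip
  l2_ipC l2_ipDl l2_ipZl l2_ip_ge0 l2_ip_eq0 l2_complete.

End L2.

Arguments l2_ipP {R Y} u v.
Arguments l2_nsqP {R Y} u.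

Local Open Scope complex_scope.
Local Notation Re := complex.Re.
Local Notation Im := complex.Im.

(** * Complex Hilbert spaces with an orthonormal basis *)

(** A complex Hilbert space with an orthonormal basis [bvec] indexed by [X],
   encoded by the underlying real space and the multiplication [J] by the
   imaginary unit.  The complex inner product is ['[u, v] +i* '[u, J v]]. *)
Record based_hilbert (R : realType) (X : choiceType) := BasedHilbert {
  based_space :> hilbert R;
  J : based_space -> based_space;
  bvec : X -> based_space;
  J_skew : forall u v, '[J u, v] = - '[u, J v];
  JJ : forall u, J (J u) = - u;
  parseval : forall u v, has_sum
    (fun y => ('[u, bvec y] +i* '[u, J (bvec y)]) *
              ('[bvec y, v] +i* '[bvec y, J v])) ('[u, v] +i* '[u, J v]);
  riesz_fischer : forall (a : X -> R[i]) (B : R),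
    (forall A, partial_sum (fun y => Re (a y) ^+ 2 + Im (a y) ^+ 2) A <= B) ->
    exists2 u, forall y, '[u, bvec y] +i* '[u, J (bvec y)] = a y & '[u] <= B;
  bvec_orthonormal : forall x y,
    '[bvec x, bvec y] +i* '[bvec x, J (bvec y)] = (x == y)%:R
}.

Section ComplexSums.
Variables (R : realType) (Y : choiceType).

Lemma Re_add (a b : R[i]) : Re (a + b) = Re a + Re b.
Proof. by case: a b => [? ?] []. Qed.

Lemma Im_add (a b : R[i]) : Im (a + b) = Im a + Im b.
Proof. by case: a b => [? ?] []. Qed.

Lemma Re_sum I (r : seq I) (f : I -> R[i]) :
  Re (\sum_(i <- r) f i) = \sum_(i <- r) Re (f i).
Proof. exact: (big_morph _ Re_add erefl). Qed.

Lemma Im_sum I (r : seq I) (f : I -> R[i]) :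
  Im (\sum_(i <- r) f i) = \sum_(i <- r) Im (f i).
Proof. exact: (big_morph _ Im_add erefl). Qed.

Lemma norm_complex_le (a b : R) : `|a +i* b| <= (`|a| + `|b|)%:C.
Proof.
rewrite normc_def lecR /= -(ler_sqr) ?nnegrE ?sqrtr_ge0 ?addr_ge0//.
rewrite sqr_sqrtr ?addr_ge0 ?sqr_ge0// sqrrD !real_normK ?num_real//.
by rewrite addrAC lerDl mulrn_wge0// mulr_ge0.
Qed.

Lemma Re_le_norm (z : R[i]) e : `|z| <= e -> Re z <= Re e.
Proof.
move=> ze; have := le_trans (normc_ge_Re z) ze.
by rewrite lecE /= => /andP[_]; apply: le_trans; exact: ler_norm.
Qed.

Lemma has_sum_complex (f g : Y -> R) a b : has_sum f a -> has_sum g b ->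
  has_sum (fun y => f y +i* g y) (a +i* b).
Proof.
move=> fa gb; apply/cvgrPdist_le => e; rewrite ltcE /= => /andP[/eqP Ime Ree].
have e2 : 0 < Re e / 2 by rewrite divr_gt0.
move/cvgrPdist_le : fa => /(_ _ e2)[A _ fA].
move/cvgrPdist_le : gb => /(_ _ e2)[B _ gB].
exists (A `|` B)%fset => // C /=; rewrite fsubUset => /andP[AC BC].
have -> : partial_sum (fun y => f y +i* g y) C =
    partial_sum f C +i* partial_sum g C.
  rewrite !partial_sumE; apply/eqP; rewrite eq_complex Re_sum Im_sum.
  by rewrite !eqxx.
rewrite (le_trans (norm_complex_le _ _))// lecE /= Ime eqxx /=.
by have := fA _ AC; have := gB _ BC; rewrite /=; lra.
Qed.

(** Beyond some finite set [A0] the partial sums are within [1] of the sum, and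
   the partial sum over [A] is at most the one over the union of [A] and [A0]. *)
Lemma has_sum_bounded (f : Y -> R[i]) s : (forall y, 0 <= f y) -> has_sum f s ->
  exists B, forall A, partial_sum (fun y => Re (f y)) A <= B.
Proof.
move=> f0 /cvgrPdist_le/(_ _ ltr01)[A0 _ fA0].
exists (Re s + 1) => A; pose C := (A `|` A0)%fset.
have Re0 y : 0 <= Re (f y) by have := f0 y; rewrite lecE => /andP[].
rewrite (le_trans (partial_sum_le Re0 (fsubsetUl A A0)))//.
have /= := fA0 C (fsubsetUr A A0).
rewrite -normrN opprB => /Re_le_norm.
by rewrite Re_add partial_sumE /= partial_sumE Re_sum; case: (s) => ? ? /=; lra.
Qed.

End ComplexSums.

(** The square of a real space, its elements read as [u.1 + i u.2]. *)
Section Complexification.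
Variables (R : realType) (V : hilbert R).
Local Notation H := (prod_hilbert V V).

Definition cplx_J (u : H) : H := (- u.2, u.1).

Lemma prod_ipE (u v : H) : '[u, v] = '[u.1, v.1] + '[u.2, v.2].
Proof. by []. Qed.

Fact cplx_J_skew u v : '[cplx_J u, v] = - '[u, cplx_J v].
Proof. by rewrite !prod_ipE /= ipNl ipNr opprD opprK addrC. Qed.

Fact cplx_JJ u : cplx_J (cplx_J u) = - u.
Proof. by case: u. Qed.

End Complexification.

Section ConcreteModel.
Variables (R : realType) (X : choiceType).
Local Notation V := (l2_hilbert R X).
Local Notation H := (prod_hilbert V V).

Lemma has_sum_single (f : X -> R) x : (forall y, y != x -> f y = 0) ->
  has_sum f (f x).
Proof.
move=> f0; apply: cvg_near_cst; exists [fset x]%fset => // A /= xA.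
rewrite partial_sumE (big_fsetD1 x) ?(fsubsetP xA) ?inE//= big_seq big1 ?addr0//.
by move=> y; rewrite !inE => /andP[/f0].
Qed.

Fact delta_subproof (x : X) : (fun y => (y == x)%:R) \in @l2_pred R X.
Proof.
apply/asboolP; exists 1 => A.
have := @has_sum_single (fun y => (y == x)%:R ^+ 2) x.
rewrite eqxx expr1n => h.
apply: (has_sum_ge _ _ (h _)) => y; first exact: sqr_ge0.
by move/negPf ->; rewrite expr0n.
Qed.

Definition l2_delta (x : X) : V := L2 (delta_subproof x).

Lemma ip_l2_delta (u : V) x : '[u, l2_delta x] = (u : l2 R X) x.
Proof.
have ux : has_sum (fun y => (u : l2 R X) y * (l2_delta x : l2 R X) y)
    ((u : l2 R X) x).
  have := @has_sum_single (fun y => (u : l2 R X) y * (y == x)%:R) x.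
  by rewrite eqxx mulr1; apply=> y /negPf ->; rewrite mulr0.
exact: has_sum_unique (l2_ipP u (l2_delta x)) ux.
Qed.

Local Notation J := (@cplx_J R V).
Definition l2_bvec (x : X) : H := (l2_delta x, 0).

Lemma ip_l2_bvec (u : H) y : '[u, l2_bvec y] = (u.1 : l2 R X) y.
Proof. by rewrite prod_ipE ip0r addr0 ip_l2_delta. Qed.

Lemma ip_J_l2_bvec (u : H) y : '[u, J (l2_bvec y)] = (u.2 : l2 R X) y.
Proof.
rewrite -[LHS]/('[u.1, - (0 : V)] + '[u.2, l2_delta y]).
by rewrite oppr0 ip0r add0r ip_l2_delta.
Qed.

Lemma l2_coordE (u : H) y :
  '[u, l2_bvec y] +i* '[u, J (l2_bvec y)] =
  (u.1 : l2 R X) y +i* (u.2 : l2 R X) y.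
Proof. by rewrite ip_l2_bvec ip_J_l2_bvec. Qed.

Lemma l2_coord_conjE (u : H) y :
  '[l2_bvec y, u] +i* '[l2_bvec y, J u] =
  (u.1 : l2 R X) y +i* - (u.2 : l2 R X) y.
Proof.
by rewrite ipC ip_l2_bvec ipC cplx_J_skew ip_J_l2_bvec.
Qed.

Fact l2_parseval (u v : H) : has_sum
  (fun y => ('[u, l2_bvec y] +i* '[u, J (l2_bvec y)]) *
            ('[l2_bvec y, v] +i* '[l2_bvec y, J v])) ('[u, v] +i* '[u, J v]).
Proof.
have re := has_sumD (l2_ipP u.1 v.1) (l2_ipP u.2 v.2).
have im := has_sumD (has_sumZ (a := -1) (l2_ipP u.1 v.2)) (l2_ipP u.2 v.1).
have -> : '[u, v] +i* '[u, J v] =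
    (l2_ip u.1 v.1 + l2_ip u.2 v.2) +i* (-1 * l2_ip u.1 v.2 + l2_ip u.2 v.1).
  by rewrite mulN1r -[l2_ip u.1 v.2]/('[u.1, v.2]) -ipNr.
have := has_sum_complex re im.
congr (has_sum _ _); apply/funext => y; rewrite l2_coordE l2_coord_conjE.
apply/eqP; rewrite eq_complex /=; apply/andP.
by split; apply/eqP; ring.
Qed.

Fact l2_riesz_fischer (a : X -> R[i]) (B : R) :
  (forall A, partial_sum (fun y => Re (a y) ^+ 2 + Im (a y) ^+ 2) A <= B) ->
  exists2 u : H, forall y, '[u, l2_bvec y] +i* '[u, J (l2_bvec y)] = a y &
    '[u] <= B.
Proof.
move=> aB.
have half (f g : X -> R) :
    (forall A, partial_sum (fun y => f y ^+ 2 + g y ^+ 2) A <= B) ->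
    f \in @l2_pred R X.
  move=> fgB; apply/asboolP; exists B => A; apply: le_trans (fgB A).
  by rewrite !partial_sumE; apply: ler_sum => y _; rewrite lerDl sqr_ge0.
have ReL : (fun y => Re (a y)) \in @l2_pred R X by exact: half aB.
have ImL : (fun y => Im (a y)) \in @l2_pred R X.
  by apply: (half _ (fun y => Re (a y))) => A; under eq_fun do rewrite addrC.
exists (L2 ReL, L2 ImL); first move=> y.
  by rewrite l2_coordE -[LHS]/(Re (a y) +i* Im (a y)); case: (a y).
have [y|s us sB] := has_sum_ex _ aB; first by rewrite addr_ge0 ?sqr_ge0.
rewrite (_ : '[_] = s)//; apply: has_sum_unique _ us.
exact: (has_sumD (l2_nsqP (L2 ReL)) (l2_nsqP (L2 ImL))).
Qed.

Fact l2_bvec_orthonormal x y :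
  '[l2_bvec x, l2_bvec y] +i* '[l2_bvec x, J (l2_bvec y)] = (x == y)%:R.
Proof.
by rewrite l2_coordE -[LHS]/((y == x)%:R +i* 0) eq_sym; case: (x == y).
Qed.

Definition l2_based : based_hilbert R X := @BasedHilbert R X H J l2_bvec
  (@cplx_J_skew R V) (@cplx_JJ R V) l2_parseval l2_riesz_fischer
  l2_bvec_orthonormal.

End ConcreteModel.

Arguments J {R X b} u.
Arguments bvec {R X b} x.

(** * Sesquilinear forms of kernels *)

Section KernelForms.
Variables (R : realType) (X : choiceType).
Implicit Types (K : X -> X -> R[i]) (s t : seq (R[i] * X)).

Lemma conjE (z : R[i]) : (z^*)%R = conjc z. Proof. by []. Qed.

Definition kform K s t : R[i] :=
  \sum_(p <- s) \sum_(q <- t) p.1 * (q.1^*)%R * K p.2 q.2.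

Lemma posdefP K : posdef K <-> forall s, 0 <= kform K s s.
Proof.
split=> [pK s|pK n x l]; last first.
  have := pK [seq (l j, x j) | j <- enum 'I_n.+1].
  rewrite /kform big_map big_enum/=.
  by under eq_bigr do rewrite big_map big_enum/=.
case: s => [|p s]; first by rewrite /kform big_nil.
have := pK (size s) (fun j => (tnth (in_tuple (p :: s)) j).2)
  (fun j => (tnth (in_tuple (p :: s)) j).1).
rewrite /kform (big_tnth _ _ (p :: s))/=.
by under [in X in _ -> X]eq_bigr do rewrite (big_tnth _ _ (p :: s))/=.
Qed.

Lemma kform_catl K s s' t : kform K (s ++ s') t = kform K s t + kform K s' t.
Proof. by rewrite /kform big_cat. Qed.

Lemma kform_catr K s t t' : kform K s (t ++ t') = kform K s t + kform K s t'.
Proof.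
by rewrite /kform -big_split; apply: eq_bigr => p _; rewrite big_cat.
Qed.

Definition fscale z s := [seq (z * p.1, p.2) | p : R[i] * X <- s].

Lemma kform_scalel K z s t : kform K (fscale z s) t = z * kform K s t.
Proof.
rewrite /kform big_map mulr_sumr; apply: eq_bigr => p _.
by rewrite mulr_sumr; apply: eq_bigr => q _; rewrite /= !mulrA.
Qed.

Lemma kform_scaler K z s t : kform K s (fscale z t) = (z^*)%R * kform K s t.
Proof.
rewrite /kform mulr_sumr; apply: eq_bigr => p _.
rewrite big_map mulr_sumr; apply: eq_bigr => q _.
by rewrite /= rmorphM /=; ring.
Qed.

Lemma kformB K L s t :
  kform (fun x y => L x y - K x y) s t = kform L s t - kform K s t.
Proof.
rewrite /kform -sumrB; apply: eq_bigr => p _.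
by rewrite -sumrB; apply: eq_bigr => q _; rewrite mulrBr.
Qed.

Lemma kform1 K z w x y : kform K [:: (z, x)] [:: (w, y)] = z * (w^*)%R * K x y.
Proof. by rewrite /kform !big_seq1. Qed.

(** The form is real at [(1, x) + (1, y)] and at [(1, x) + (i, y)], which gives
   the imaginary and the real part of the equality. *)
Lemma posdef_herm K x y : posdef K -> K y x = (K x y)^*%R.
Proof.
move=> /posdefP pK.
have := pK [:: (1, x)]; have := pK [:: (1, y)].
have := pK ([:: (1, x)] ++ [:: (1, y)]).
have := pK ([:: (1, x)] ++ [:: ('i%C, y)]).
rewrite !(kform_catl, kform_catr, kform1) !conjE.
case: (K x y) => a b; case: (K y x) => c d.
case: (K x x) => a1 b1; case: (K y y) => a2 b2.
rewrite !lecE /=.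
move=> /andP[/eqP h1 _] /andP[/eqP h2 _] /andP[/eqP h3 _] /andP[/eqP h4 _].
apply/eqP; rewrite eq_complex /=; apply/andP.
by split; apply/eqP; lra.
Qed.

Lemma kform_herm K s t : posdef K -> kform K t s = ((kform K s t)^*)%R.
Proof.
move=> pK; rewrite /kform rmorph_sum exchange_big; apply: eq_bigr => p _ /=.
rewrite rmorph_sum; apply: eq_bigr => q _ /=.
by rewrite !rmorphM /= conjCK -posdef_herm//; ring.
Qed.

(** Real multiples of [t] suffice for the discriminant argument, as only the
   real part of [kform K s t] is bounded. *)
Lemma kform_CS K s t : posdef K ->
  Re (kform K s t) ^+ 2 <= Re (kform K s s) * Re (kform K t t).
Proof.
move=> pK; have /posdefP pK' := pK.
rewrite mulrC; apply: quad_discr => [|a].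
  by have := pK' t; rewrite lecE => /andP[].
have := pK' (s ++ fscale a%:C t).
rewrite !(kform_catl, kform_catr, kform_scalel, kform_scaler).
rewrite (kform_herm s t pK).
rewrite lecE => /andP[_]; rewrite !conjE.
case: (kform K s s) => a1 b1; case: (kform K s t) => a2 b2.
case: (kform K t t) => a3 b3.
rewrite /=; lra.
Qed.

End KernelForms.

Lemma complex_eq (R : realType) (a b : R[i]) :
  Re a = Re b -> Im a = Im b -> a = b.
Proof. by case: a b => [? ?] [? ?] /= -> ->. Qed.

(** * Matrix square roots as families of vectors *)

Section ComplexIp.
Variables (R : realType) (X : choiceType) (H : based_hilbert R X).
Implicit Types (u v w : H) (m n : X -> H) (s t : seq (R[i] * X)) (z : R[i]).
Local Notation e := (@bvec R X H).

Lemma J_adjointable : adjointable (@J R X H).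
Proof. by exists (fun v => - J v) => u v; rewrite J_skew ipNr. Qed.

Lemma JD u v : J (u + v) = J u + J v.
Proof. exact: adjointableD J_adjointable. Qed.

Lemma JZ a u : J (a *: u) = a *: J u.
Proof. exact: adjointableZ J_adjointable. Qed.

Lemma JN u : J (- u) = - J u.
Proof. by rewrite -scaleN1r JZ scaleN1r. Qed.

Lemma JB u v : J (u - v) = J u - J v.
Proof. by rewrite JD JN. Qed.

Lemma J0 : J (0 : H) = 0.
Proof. by have := JZ 0 0; rewrite !scale0r. Qed.

Lemma ip_J u v : '[J u, J v] = '[u, v].
Proof. by rewrite J_skew JJ ipNr opprK. Qed.

Lemma ip_Jid u : '[u, J u] = 0.
Proof. by have := J_skew u u; rewrite ipC; lra. Qed.

Definition hc u v : R[i] := '[u, v] +i* '[u, J v].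
Definition cplx_scale z u := Re z *: u + Im z *: J u.

Lemma hcDl u v w : hc (u + v) w = hc u w + hc v w.
Proof. by apply: complex_eq; rewrite /hc /= !ipDl. Qed.

Lemma hcDr u v w : hc u (v + w) = hc u v + hc u w.
Proof. by apply: complex_eq; rewrite /hc /= ?JD ipDr. Qed.

Lemma hc0l u : hc 0 u = 0.
Proof. by apply: complex_eq; rewrite /hc /= ip0l. Qed.

Lemma hc0r u : hc u 0 = 0.
Proof. by apply: complex_eq; rewrite /hc /= ?J0 ip0r. Qed.

Lemma hcC u v : hc v u = (hc u v)^*%R.
Proof. by apply: complex_eq; rewrite /hc /= ipC// J_skew. Qed.

Lemma hcNl u v : hc (- u) v = - hc u v.
Proof. by apply: complex_eq; rewrite /hc /= ipNl. Qed.

Lemma hcBl u v w : hc (u - v) w = hc u w - hc v w.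
Proof. by rewrite hcDl hcNl. Qed.

Lemma hcBr u v w : hc u (v - w) = hc u v - hc u w.
Proof. by rewrite hcC hcBl rmorphB /= -!hcC. Qed.

Lemma hcJl u v : hc (J u) v = 'i%C * hc u v.
Proof.
by apply: complex_eq; rewrite /hc /= ?ip_J ?J_skew; ring.
Qed.

Lemma hcZl z u v : hc (cplx_scale z u) v = z * hc u v.
Proof.
case: z => a b; apply: complex_eq;
  by rewrite /hc /cplx_scale /= ipDl !ipZl ?ip_J ?J_skew; ring.
Qed.

Lemma hcZr z u v : hc u (cplx_scale z v) = (z^*)%R * hc u v.
Proof. by rewrite hcC hcZl rmorphM (hcC v u). Qed.

Lemma hc_nsq u : hc u u = '[u]%:C.
Proof. by apply: complex_eq; rewrite /hc //= ip_Jid. Qed.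

Lemma hc_eq0 u v : '[u, v] = 0 -> '[u, J v] = 0 -> hc u v = 0.
Proof. by move=> ? ?; apply: complex_eq. Qed.

Lemma hc_parseval u v : has_sum (fun y => hc u (e y) * hc (e y) v) (hc u v).
Proof. exact: parseval. Qed.
Arguments hc_parseval : clear implicits.

Lemma hc_total u v : (forall y, hc u (e y) = hc v (e y)) -> u = v.
Proof.
move=> uv; apply/eqP; rewrite -subr_eq0; apply/eqP/ip_eq0.
have := hc_parseval (u - v) (u - v).
rewrite (_ : (fun y => _) = fun=> 0); last first.
  by apply/funext => y; rewrite hcBl uv subrr mul0r.
have sum0 : has_sum (fun _ : X => (0 : R[i])) 0.
  apply/cvgrPdist_le => eps eps0; exists fset0 => // A _ /=.
  by rewrite /partial_sum big1// subrr normr0 ltW.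
by move=> /has_sum_unique/(_ sum0); rewrite hc_nsq => -[].
Qed.

Lemma hc_orthonormal x y : hc (e x) (e y) = (x == y)%:R.
Proof. exact: bvec_orthonormal. Qed.

Definition comb m s : H := \sum_(p <- s) cplx_scale p.1 (m p.2).

Lemma hc_suml I (r : seq I) (f : I -> H) v :
  hc (\sum_(i <- r) f i) v = \sum_(i <- r) hc (f i) v.
Proof. by apply: (big_morph (hc^~ v)) => [a b|]; [exact: hcDl|exact: hc0l]. Qed.

Lemma hc_sumr I (r : seq I) (f : I -> H) v :
  hc v (\sum_(i <- r) f i) = \sum_(i <- r) hc v (f i).
Proof. by apply: (big_morph (hc v)) => [a b|]; [exact: hcDr|exact: hc0r]. Qed.

Lemma hc_comb m n s t :
  hc (comb m s) (comb n t) = kform (fun x y => hc (m x) (n y)) s t.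
Proof.
rewrite /comb hc_suml /kform; apply: eq_bigr => p _.
rewrite hc_sumr; apply: eq_bigr => q _.
by rewrite hcZl hcZr mulrA.
Qed.

Lemma hc_combl m s v : hc (comb m s) v = \sum_(p <- s) p.1 * hc (m p.2) v.
Proof. by rewrite /comb hc_suml; apply: eq_bigr => p _; rewrite hcZl. Qed.

Lemma comb_cat m s t : comb m (s ++ t) = comb m s + comb m t.
Proof. by rewrite /comb big_cat. Qed.

Lemma comb1 m x : comb m [:: (1, x)] = m x.
Proof. by rewrite /comb big_seq1 /cplx_scale /= scale1r scale0r addr0. Qed.

(** By Parseval's identity the matrix product of [M] with itself is the Gram
   matrix of its rows [m x], so the roots of [K] are the families of vectors
   with Gram matrix [K] and a positive definite coordinate matrix. *)
Definition root_vectors m (K : X -> X -> R[i]) :=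
  posdef (fun x y => hc (m x) (e y)) /\ forall x y, hc (m x) (m y) = K x y.

Lemma root_vectors_sqrt m K : root_vectors m K ->
  matrix_sqrt (fun x y => hc (m x) (e y)) K.
Proof.
move=> [pm mK]; split=> // x z; rewrite -mK.
have := hc_parseval (m x) (m z).
congr (has_sum _ _); apply/funext => y.
by rewrite (hcC (m z)) -(posdef_herm z y pm).
Qed.

Lemma matrix_sqrt_vectors (M K : X -> X -> R[i]) : matrix_sqrt M K ->
  exists2 m, root_vectors m K & forall x y, M x y = hc (m x) (e y).
Proof.
move=> [pM MK].
have /choice[m mE] x : exists u : H, forall y, hc u (e y) = M x y.
  have [|B BM] := has_sum_bounded _ (MK x x).
    by move=> y; rewrite (posdef_herm x y pM) mul_conjC_ge0.
  have [A|u uE _] := @riesz_fischer _ _ H (M x) B; last by exists u.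
  rewrite (le_trans _ (BM A))// le_eqVlt; apply/orP; left; apply/eqP.
  congr partial_sum; apply/funext => y.
  by rewrite (posdef_herm x y pM) conjE; case: (M x y) => a b /=; ring.
exists m => //; split.
  by rewrite (_ : (fun x y => _) = M)//; apply/funext => x; apply/funext => y.
move=> x z; have := hc_parseval (m x) (m z).
rewrite (_ : (fun y => _) = fun y => M x y * M y z).
  by move=> /has_sum_unique; apply; exact: MK.
by apply/funext => y; rewrite (hcC (m z)) !mE -(posdef_herm z y pM).
Qed.

End ComplexIp.

Section ComplexLimits.
Variables (R : realType) (X : choiceType) (H : based_hilbert R X).

Lemma hlim_J (f : nat -> H) u : hlim f u -> hlim (fun n => J (f n)) (J u).
Proof.
move=> fu; apply: (@hlim_contract _ H H (@J R X H) 1 _ _ _ fu) => v w.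
by rewrite -JB ip_J mul1r.
Qed.

Lemma hlim_comb (f : nat -> X -> H) (l : X -> H) s :
  (forall x, hlim (fun n => f n x) (l x)) ->
  hlim (fun n => comb (f n) s) (comb l s).
Proof.
move=> fl; rewrite /comb; elim: s => [|p s IH].
  by rewrite big_nil; under eq_fun do rewrite big_nil; exact: hlim_cst.
rewrite big_cons; under eq_fun do rewrite big_cons.
apply: hlimD => //; apply: hlimD; apply: hlimZ => //.
exact: hlim_J.
Qed.

End ComplexLimits.

Arguments hc_parseval {R X H} u v.

(** * Bounded kernels as operators *)

Section BoundedKernels.
Variables (R : realType) (X : choiceType) (H : based_hilbert R X).
Implicit Types (u v w : H) (m : X -> H) (s t : seq (R[i] * X)) (z : R[i]).
Implicit Types (K L : X -> X -> R[i]).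
Local Notation e := (@bvec R X H).

Lemma cplx_scale_real (a : R) u : cplx_scale a%:C u = a *: u.
Proof. by rewrite /cplx_scale /= scale0r addr0. Qed.

Lemma comb_scale m z s : comb m (fscale z s) = cplx_scale z (comb m s).
Proof.
apply: hc_total => y; rewrite hcZl !hc_combl big_map mulr_sumr.
by apply: eq_bigr => p _; rewrite mulrA.
Qed.

Lemma lin_subspace_comb m : lin_subspace (fun u => exists s, u = comb m s).
Proof.
split=> [|a u v [s ->] [t ->]]; first by exists [::]; rewrite /comb big_nil.
exists (fscale a%:C s ++ t).
by rewrite comb_cat comb_scale cplx_scale_real.
Qed.

(** A vector orthogonal to every [e y] and [J (e y)] has zero coordinates. *)
Lemma comb_dense u : exists s : nat -> seq (R[i] * X),
  hlim (fun n => comb e (s n)) u.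
Proof.
have [|t tP tu] := @adherent_hlim _ _ (fun u => exists s, u = comb e s) u.
  apply: dense_lin_subspace; first exact: lin_subspace_comb.
  move=> v ve; apply: hc_total => y; rewrite hc0l hcC.
  apply/eqP; rewrite conjC_eq0; apply/eqP.
  apply: complex_eq; rewrite /hc/=.
    by rewrite ipC ve//; exists [:: (1, y)]; rewrite comb1.
  rewrite -[LHS]opprK -J_skew ipC ve ?oppr0//.
  exists [:: ('i%C, y)].
  by rewrite /comb big_seq1 /cplx_scale /= scale0r scale1r add0r.
have /choice[s sP] := tP.
by exists s; rewrite (_ : (fun n => _) = t)//; apply/funext.
Qed.

Lemma kform_delta (c : R) s :
  kform (fun x y => c%:C * delta R X x y) s s = (c * '[comb e s])%:C.
Proof.
rewrite rmorphM /= -hc_nsq hc_comb /kform mulr_sumr; apply: eq_bigr => p _.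
rewrite mulr_sumr; apply: eq_bigr => q _.
by rewrite hc_orthonormal /delta; ring.
Qed.

Lemma dominated_delta K (c : R) :
  dominated K (fun x y => c%:C * delta R X x y) ->
  forall s, Re (kform K s s) <= c * '[comb e s].
Proof.
move=> /posdefP Kc s; have := Kc s; rewrite kformB kform_delta.
by case: (kform K s s) => a b; rewrite lecE /= => /andP[_]; lra.
Qed.

(** The combination with coefficients [a] on [A].  Tested on it, a form with row
   [a] takes the value [abs2 a A], which bounds the square sums of rows. *)
Definition restr (a : X -> R[i]) (A : {fset X}) : seq (R[i] * X) :=
  [seq (a y, y) | y <- A].

Definition abs2 (a : X -> R[i]) (A : {fset X}) : R :=
  partial_sum (fun y => Re (a y) ^+ 2 + Im (a y) ^+ 2) A.

Lemma abs2_ge0 a A : 0 <= abs2 a A.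
Proof.
by rewrite /abs2 partial_sumE sumr_ge0// => y _; rewrite addr_ge0 ?sqr_ge0.
Qed.

Lemma abs2E a A : (abs2 a A)%:C = \sum_(y <- A) (a y)^*%R * a y.
Proof.
rewrite /abs2 partial_sumE rmorph_sum; apply: eq_bigr => y _ /=.
by apply: complex_eq; rewrite conjE; case: (a y) => ? ? /=; ring.
Qed.

Lemma hc_restr m a A u :
  hc u (comb m (restr a A)) = \sum_(y <- A) (a y)^*%R * hc u (m y).
Proof.
rewrite hcC hc_combl big_map rmorph_sum; apply: eq_bigr => y _.
by rewrite rmorphM (hcC (m y) u).
Qed.

Lemma nsq_restr a A : '[comb e (restr a A)] = abs2 a A.
Proof.
apply: complexI; rewrite -hc_nsq hc_restr abs2E big_seq [RHS]big_seq.
apply: eq_bigr => y yA; congr (_ * _).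
rewrite hc_combl big_map (big_fsetD1 y)//= hc_orthonormal eqxx mulr1.
rewrite big_seq big1 ?addr0// => x; rewrite !inE => /andP[xy _].
by rewrite hc_orthonormal (negPf xy) mulr0.
Qed.

Lemma cancel_square (t b : R) : 0 <= t -> 0 <= b -> t ^+ 2 <= b * t -> t <= b.
Proof.
rewrite le_eqVlt => /predU1P[<-//|t0] _.
by rewrite expr2 ler_pM2r.
Qed.

Section Operator.
Variables (L : X -> X -> R[i]) (c : R).
Hypothesis pL : posdef L.
Hypothesis Lc : dominated L (fun x y => c%:C * delta R X x y).

(** Riesz-Fischer applies to the row [a] of the form at [s]: with [t = abs2 a A]
   and [g = restr a A], the form is [t] at [(s, g)], and the Cauchy-Schwarz
   inequality gives [t ^ 2 <= L(s, s) L(g, g) <= c '[comb e s] * c t]. *)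
Lemma bounded_kernel_vector s : exists w,
  (forall y, hc w (e y) = kform L s [:: (1, y)]) /\
  '[w] <= c ^+ 2 * '[comb e s].
Proof.
set B := c ^+ 2 * '[comb e s].
have [|w wE wB] := @riesz_fischer _ _ H (fun y => kform L s [:: (1, y)]) B.
  2: by exists w.
pose a y := kform L s [:: (1, y)].
move=> A; rewrite -/(abs2 a A).
have tE : kform L s (restr a A) = (abs2 a A)%:C.
  rewrite abs2E /kform exchange_big big_map; apply: eq_bigr => y _.
  rewrite /a /kform mulr_sumr; apply: eq_bigr => p _.
  by rewrite big_seq1 /= rmorph1; ring.
rewrite /B; apply: cancel_square.
- exact: abs2_ge0.
- by rewrite mulr_ge0 ?sqr_ge0 ?ip_ge0.
- have := kform_CS s (restr a A) pL; rewrite tE /= => /le_trans; apply.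
  rewrite expr2 -mulrA mulrACA; apply: ler_pM.
  + by have /posdefP/(_ s) := pL; rewrite lecE => /andP[].
  + by have /posdefP/(_ (restr a A)) := pL; rewrite lecE => /andP[].
  + exact: dominated_delta.
  + by rewrite -nsq_restr; exact: dominated_delta.
Qed.

(** The vectors representing the rows of [L] have bounded combinations, so the
   formula [hc (A u) (e y) = hc u (l y)] defines a bounded operator [A]. *)
Lemma bounded_operator : exists A : H -> H,
  [/\ symop A, posop A, forall u, '[A u, u] <= c * '[u],
      forall u, J (A u) = A (J u) & forall x y, hc (A (e x)) (e y) = L x y].
Proof.
have [T TP] := choice bounded_kernel_vector.
pose l x := T [:: (1, x)].
have lE x y : hc (l x) (e y) = L x y.
  by have [-> _] := TP [:: (1, x)]; rewrite kform1 rmorph1 !mul1r.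
have TE s : T s = comb l s.
  apply: hc_total => y; have [-> _] := TP s; rewrite hc_combl.
  by apply: eq_bigr => p _; rewrite big_seq1 lE rmorph1 mulr1.
have lb s : '[comb l s] <= c ^+ 2 * '[comb e s] by rewrite -TE; have [] := TP s.
have /choice[A AP] u : exists w,
    (forall y, hc w (e y) = hc u (l y)) /\ '[w] <= c ^+ 2 * '[u].
  have [|w wE wB] := @riesz_fischer _ _ H (fun y => hc u (l y)) (c ^+ 2 * '[u]).
    2: by exists w.
  pose a y := hc u (l y).
  move=> A; rewrite -/(abs2 a A); apply: cancel_square.
  - exact: abs2_ge0.
  - by rewrite mulr_ge0 ?sqr_ge0 ?ip_ge0.
  - have tE : '[u, comb l (restr a A)] = abs2 a A.
      by rewrite -[LHS]/(Re (hc _ _)) hc_restr -abs2E.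
    rewrite -tE (le_trans (CS _ _))// tE mulrC mulrAC.
    by rewrite ler_wpM2r ?ip_ge0// -nsq_restr.
have AE u y : hc (A u) (e y) = hc u (l y) by have [] := AP u.
have Ab u : '[A u] <= c ^+ 2 * '[u] by have [] := AP u.
have AB u v : A (u - v) = A u - A v.
  by apply: hc_total => y; rewrite hcBl !AE hcBl.
have AJ u : J (A u) = A (J u).
  by apply: hc_total => y; rewrite hcJl !AE hcJl.
have Acomb s : A (comb e s) = comb l s.
  apply: hc_total => y; rewrite AE !hc_combl; apply: eq_bigr => p _.
  by rewrite hcC !lE -posdef_herm.
have Alim (s : nat -> H) u : hlim s u -> hlim (fun n => A (s n)) (A u).
  by apply: (@hlim_contract _ _ _ A (c ^+ 2)) => v w; rewrite -AB.
have sA : symop A.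
  move=> u v; have [s sv] := comb_dense v.
  apply: (cvg_unique _ (hlim_ip (hlim_cst (A u)) sv)) => //.
  have -> : (fun n => '[A u, comb e (s n)]) = (fun n => '[u, A (comb e (s n))]).
    apply/funext => n; rewrite Acomb -[LHS]/(Re (hc _ _)) -[RHS]/(Re (hc _ _)).
    congr Re; rewrite hcC [RHS]hcC !hc_combl.
    by congr (_ ^*)%R; apply: eq_bigr => p _; rewrite hcC AE -hcC.
  exact: hlim_ip (hlim_cst u) (Alim _ _ sv).
have quad s : '[A (comb e s), comb e s] = Re (kform L s s).
  rewrite Acomb -[LHS]/(Re (hc _ _)) hc_comb; congr Re.
  by apply: eq_bigr => p _; apply: eq_bigr => q _; rewrite lE.
exists A; split=> //.
- move=> u; have [s su] := comb_dense u.
  apply: (cvgn_ge_bound (hlim_ip (Alim _ _ su) su)) => n.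
  by rewrite quad; have /posdefP/(_ (s n)) := pL; rewrite lecE => /andP[].
- move=> u; have [s su] := comb_dense u; rewrite -subr_ge0.
  apply: (cvgn_ge_bound
    (cvgB (cvgM (cvg_cst c) (hlim_ip su su)) (hlim_ip (Alim _ _ su) su))) => n.
  rewrite -[leRHS]/(c * '[comb e (s n)] - '[A (comb e (s n)), comb e (s n)]).
  by rewrite subr_ge0 quad; exact: dominated_delta.
- by move=> x y; rewrite AE hcC lE -posdef_herm.
Qed.

End Operator.

End BoundedKernels.

(** * Square roots of bounded kernels *)

Section BoundedRoots.
Variables (R : realType) (X : choiceType) (H : based_hilbert R X).
Implicit Types (u v w : H) (m : X -> H) (s t : seq (R[i] * X)) (z : R[i]).
Implicit Types (K L M N : X -> X -> R[i]).
Local Notation e := (@bvec R X H).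

Lemma dominated_trans K L N : dominated K L -> dominated L N -> dominated K N.
Proof.
move=> /posdefP KL /posdefP LN; apply/posdefP => s.
have := addr_ge0 (KL s) (LN s); rewrite !kformB.
by rewrite addrC addrA subrK.
Qed.

Lemma symop_cplx_scale (A : H -> H) z u :
  symop A -> (forall u, J (A u) = A (J u)) ->
  A (cplx_scale z u) = cplx_scale z (A u).
Proof.
by move=> sA JA; rewrite /cplx_scale (symopD _ _ sA) !(symopZ _ _ sA) JA.
Qed.

Lemma symop_comb (A : H -> H) m s : symop A -> (forall u, J (A u) = A (J u)) ->
  A (comb m s) = comb (A \o m) s.
Proof.
move=> sA JA; rewrite /comb; elim: s => [|p s IH].
  by rewrite !big_nil; have := symopZ 0 0 sA; rewrite !scale0r.
by rewrite !big_cons (symopD _ _ sA) IH symop_cplx_scale.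
Qed.

Lemma hc_symop (A : H -> H) u v : symop A -> (forall u, J (A u) = A (J u)) ->
  hc (A u) v = hc u (A v).
Proof. by move=> sA JA; rewrite /hc sA sA JA. Qed.

(** The form of a symmetric operator that commutes with [J] is real. *)
Lemma posdef_operator (A : H -> H) : symop A -> posop A ->
  (forall u, J (A u) = A (J u)) -> posdef (fun x y => hc (A (e x)) (e y)).
Proof.
move=> sA pA JA; apply/posdefP => s.
rewrite -(hc_comb (A \o e) e) -symop_comb// lecE /=; apply/andP; split=> //.
set u := comb e s; apply/eqP.
by have := J_skew (A u) u; rewrite JA sA; have := ipC (J u) (A u); lra.
Qed.

Lemma bounded_root L c : posdef L ->
  dominated L (fun x y => c%:C * delta R X x y) -> exists M, matrix_sqrt M L.
Proof.
move=> pL Lc.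
have [A [sA pA Ac JA AE]] := bounded_operator H pL Lc.
have [S [sS pS SS cS]] := sqrt_op sA pA Ac.
have JS : forall u, J (S u) = S (J u) by apply: cS => //; exact: J_adjointable.
exists (fun x y => hc (S (e x)) (e y)); apply: root_vectors_sqrt; split.
  exact: posdef_operator.
by move=> x z; rewrite hc_symop// SS -hc_symop.
Qed.

(** With [f = comb e s], the squared norm of [comb m s] is the value of the form
   of [K], at most [c '[f]], and [2 '[comb m s, f] <= '[comb m s] + '[f]]. *)
Lemma root_dominated M K c : matrix_sqrt M K ->
  dominated K (fun x y => c%:C * delta R X x y) ->
  dominated M (fun x y => (c + 1)%:C * delta R X x y).
Proof.
move=> MK Kc; have [m [pm mK] mE] := matrix_sqrt_vectors H MK.
apply/posdefP => s; rewrite kformB (kform_delta H).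
have kM : kform M s s = hc (comb m s) (comb e s).
  rewrite hc_comb; apply: eq_bigr => p _; apply: eq_bigr => q _.
  by rewrite mE.
have := (posdefP M).1 MK.1 s; rewrite kM !lecE /= => /andP[/eqP -> _].
rewrite subrr eqxx /= subr_ge0.
have mb : '[comb m s] <= c * '[comb e s].
  have := dominated_delta H Kc s; congr (_ <= _).
  rewrite -[RHS]/(Re '[comb m s]%:C) -hc_nsq hc_comb; congr Re.
  by apply: eq_bigr => p _; apply: eq_bigr => q _; rewrite mK.
have := ip_ge0 (comb m s - comb e s); rewrite nsqB.
by have := ip_ge0 (comb m s); have := ip_ge0 (comb e s); lra.
Qed.

Lemma root_unique M N K c : 0 <= c ->
  dominated K (fun x y => c%:C * delta R X x y) ->
  matrix_sqrt M K -> matrix_sqrt N K -> M = N.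
Proof.
move=> c0 Kc.
move=> MK NK.
have c10 : 0 <= c + 1 by rewrite addr_ge0.
have rows P (A : H -> H) : matrix_sqrt P K -> symop A ->
    (forall u, J (A u) = A (J u)) -> (forall x y, hc (A (e x)) (e y) = P x y) ->
    forall x y, hc (A (A (e x))) (e y) = K x y.
  move=> PK sA JA AE x y; have [m [pm mK] mE] := matrix_sqrt_vectors H PK.
  rewrite hc_symop// -mK.
  by congr hc; apply: hc_total => z; rewrite AE mE.
have [A [sA pA Ac JA AE]] := bounded_operator H MK.1 (root_dominated MK Kc).
have [B [sB pB Bc JB BE]] := bounded_operator H NK.1 (root_dominated NK Kc).
apply/funext => x; apply/funext => y; rewrite -AE -BE; congr hc.
have Ab u : '[A u] <= (c + 1) ^+ 2 * '[u].
  by rewrite expr2 -mulrA (le_trans (posop_bound u sA pA Ac))// ler_wpM2l.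
apply: (sqrt_op_unique sA pA sB pB Ab) => u; apply: hc_total => z.
rewrite !hc_symop//; congr hc; apply: hc_total => w.
by rewrite (rows M)// (rows N).
Qed.

End BoundedRoots.

(** * Unbounded kernels *)

Section UnboundedKernels.
Variables (R : realType) (X : choiceType) (H : based_hilbert R X).
Implicit Types (u v w h : H) (m : X -> H) (s t : seq (R[i] * X)) (z : R[i]).
Implicit Types (K L M N : X -> X -> R[i]).
Local Notation e := (@bvec R X H).

Definition bounded_kernel K := exists2 c : R, 0 < c &
  dominated K (fun x y => c%:C * delta R X x y).

(** [h] is in the domain of the adjoint of the densely defined operator that
   maps [e x] to [m x]. *)
Definition adjoint_dom m h := exists v, forall x, hc (m x) h = hc (e x) v.

Lemma kform_gram m K s : (forall x y, hc (m x) (m y) = K x y) ->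
  kform K s s = '[comb m s]%:C.
Proof.
move=> mK; rewrite -hc_nsq hc_comb.
by apply: eq_bigr => p _; apply: eq_bigr => q _; rewrite mK.
Qed.

Lemma adjoint_dom_comb m h v : (forall x, hc (m x) h = hc (e x) v) ->
  forall s, hc (comb m s) h = hc (comb e s) v.
Proof. by move=> hv s; rewrite !hc_combl; apply: eq_bigr => p _; rewrite hv. Qed.

(** If the adjoint of [e x |-> m x] is defined everywhere, then
   ['[comb m s, h] = '[comb e s, v]] with [v] depending only on [h], and uniform
   boundedness applies to the family of all combinations. *)
Lemma unbounded_adjoint_dom m K : (forall x y, hc (m x) (m y) = K x y) ->
  ~ bounded_kernel K -> exists h, ~ adjoint_dom m h.
Proof.
move=> mK unb; apply: contrapT => adj; apply: unb.
have [h|c c0 cP] := @uniform_bound _ H _ (comb e) (comb m).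
  have [v hv] : adjoint_dom m h by apply: contrapT => nh; apply: adj; exists h.
  by exists v => s; have /(congr1 (@complex.Re R)) := adjoint_dom_comb hv s.
exists c => //; apply/posdefP => s.
rewrite kformB (kform_delta H) (kform_gram s mK) -rmorphB /=.
by rewrite ler0c subr_ge0.
Qed.

(** The real Cauchy-Schwarz inequality at [u] and the multiple of [v] by
   [z = hc u v], for which the inner product is [|z| ^ 2]. *)
Lemma hc_CS u v : (Re (hc u v)) ^+ 2 + (Im (hc u v)) ^+ 2 <= '[u] * '[v].
Proof.
set z := hc u v; have zE : '[u, cplx_scale z v] = Re z ^+ 2 + Im z ^+ 2.
  by rewrite /cplx_scale ipDr !ipZr /z /hc /=; ring.
have := CS u (cplx_scale z v); rewrite zE.
have -> : '[cplx_scale z v] = (Re z ^+ 2 + Im z ^+ 2) * '[v].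
  by rewrite nsqD !ipE ip_Jid ip_J; ring.
rewrite mulrCA mulrC => /(@cancel_square _ _ _); apply.
  by rewrite addr_ge0 ?sqr_ge0.
by rewrite mulr_ge0 ?ip_ge0.
Qed.

Lemma mul_conjc_Re (z : R[i]) : z * (z^*)%R = (Re z ^+ 2 + Im z ^+ 2)%:C.
Proof. by apply: complex_eq; rewrite conjE; case: z => a b /=; ring. Qed.

(** A root [n] of the rank one kernel [a x * (a y)^*] has rank one, and is
   Hermitian, so that [a] is a multiple of one of its columns. *)
Lemma rank_one_root (a : X -> R[i]) (n : X -> H) :
  root_vectors n (fun x y => a x * (a y)^*%R) ->
  exists v, forall x, a x = hc (e x) v.
Proof.
move=> [pn nK].
have [a0|/existsNP[x0 /eqP ax0]] := pselect (forall x, a x = 0).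
  by exists 0 => x; rewrite hc0r a0.
have [n0|/existsNP[y0 /eqP ny0]] := pselect (forall y, hc (n x0) (e y) = 0).
  have nx0 : n x0 = 0 by apply: hc_total => y; rewrite n0 hc0l.
  have := nK x0 x0; rewrite nx0 hc0l => /esym/eqP.
  by rewrite mulf_eq0 conjC_eq0 (negPf ax0).
have nE x : n x = cplx_scale (a x / a x0) (n x0).
  apply/eqP; rewrite -subr_eq0; set w := _ - _.
  have wn y : hc w (n y) = 0 by rewrite hcBl hcZl !nK mulrA divfK// subrr.
  apply/eqP/ip_eq0/complexI.
  by rewrite -hc_nsq {2}/w hcBr hcZr !wn mulr0 subrr.
exists (cplx_scale (a x0 / hc (n x0) (e y0))^*%R (n y0)) => x.
rewrite hcZr conjCK (hcC (n y0)) -(posdef_herm y0 x pn) (nE x) hcZl.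
by field; rewrite ax0 ny0.
Qed.

(** The kernel is [a x * conj (a y)], where [a x = hc (m x) g] for a unit vector
   [g] outside the domain of the adjoint. *)
Lemma unbounded_no_root m K : root_vectors m K -> ~ bounded_kernel K ->
  exists L, [/\ posdef L, dominated L K & ~ exists M, matrix_sqrt M L].
Proof.
move=> [pm mK] unb; have [h nh] := unbounded_adjoint_dom mK unb.
have h0 : 0 < hnorm h.
  rewrite lt_neqAle hnorm_ge0 andbT eq_sym; apply/eqP => h0; apply: nh.
  exists 0 => x; rewrite hc0r; suff -> : h = 0 by rewrite hc0r.
  by apply: ip_eq0; rewrite -sqr_hnorm h0 expr0n.
pose g := (hnorm h)^-1 *: h; pose a x := hc (m x) g.
have g1 : '[g] = 1.
  rewrite -sqr_hnorm hnormZ ger0_norm ?invr_ge0 ?hnorm_ge0//.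
  by rewrite mulVf ?gt_eqF// expr1n.
have ka s : kform (fun x y => a x * (a y)^*%R) s s =
    (Re (hc (comb m s) g) ^+ 2 + Im (hc (comb m s) g) ^+ 2)%:C.
  rewrite -mul_conjc_Re hc_combl rmorph_sum /= mulr_suml.
  apply: eq_bigr => p _; rewrite mulr_sumr; apply: eq_bigr => q _.
  by rewrite rmorphM [LHS]mulrACA.
exists (fun x y => a x * (a y)^*%R); split.
- by apply/posdefP => s; rewrite ka ler0c addr_ge0 ?sqr_ge0.
- apply/posdefP => s; rewrite kformB ka (kform_gram s mK) -rmorphB /= ler0c.
  by rewrite subr_ge0 (le_trans (hc_CS _ _))// g1 mulr1.
- move=> [M ML]; have [n rn _] := matrix_sqrt_vectors H ML.
  have [v av] := rank_one_root rn; apply: nh.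
  exists (hnorm h *: v) => x; rewrite -(cplx_scale_real (hnorm h)) hcZr -av /a.
  rewrite /g -(cplx_scale_real _ h) hcZr mulrA -rmorphM -rmorphM.
  by rewrite divff ?gt_eqF// !rmorph1 mul1r.
Qed.

End UnboundedKernels.

(** * A second root of an unbounded kernel *)

Section SecondRoot.
Variables (R : realType) (X : choiceType) (H : based_hilbert R X).
Variables (m : X -> H) (K : X -> X -> R[i]) (h : H).
Hypotheses (mK : root_vectors m K) (nh : ~ adjoint_dom m h).
Local Notation E := (prod_hilbert H H).
Implicit Types (u v k l : H) (w : E) (s t : seq (R[i] * X)) (z : R[i]).
Local Notation e := (@bvec R X H).

Definition JE (u : E) : E := (J u.1, J u.2).

(** The orthogonal complement of this space is the graph of the operator [T]
   that extends the adjoint of [e x |-> m x] by [h |-> 0]: without the condition on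
   [s], the complement of the vectors [(- comb m s, comb e s)] is the graph of
   the adjoint, and the condition adds the complex multiples of [(h, 0)] to it. *)
Definition shifted_graph (w : E) :=
  exists2 s, hc (comb m s) h = 0 & w = (- comb m s, comb e s).

Lemma cplx_scale_i u : cplx_scale 'i%C u = J u.
Proof. by rewrite /cplx_scale /= scale0r scale1r add0r. Qed.

Lemma shifted_graph_subspace : lin_subspace shifted_graph.
Proof.
split=> [|a u v [s hs ->] [t ht ->]].
  exists [::]; first by rewrite /comb big_nil hc0l.
  by rewrite /comb !big_nil oppr0.
exists (fscale a%:C s ++ t).
  by rewrite comb_cat hcDl comb_scale hcZl hs ht mulr0 addr0.
by rewrite !comb_cat !comb_scale !cplx_scale_real opprD -scalerN.
Qed.

Lemma shifted_graph_J w : shifted_graph w -> shifted_graph (JE w).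
Proof.
move=> [s hs ->]; exists (fscale 'i%C s).
  by rewrite comb_scale hcZl hs mulr0.
by rewrite !comb_scale !cplx_scale_i /JE /= JN.
Qed.

Lemma JE_skew (u v : E) : '[JE u, v] = - '[u, JE v].
Proof. by rewrite !prod_ipE /= !J_skew opprD. Qed.

(** The graph of [e x |-> m x] is contained in that of its adjoint, because the
   coordinate matrix of [m] is Hermitian. *)
Lemma ortho_graph x : perp shifted_graph ((e x, m x) : E).
Proof.
move=> _ [s _ ->]; rewrite prod_ipE /= ipNr addrC; apply/eqP; rewrite subr_eq0.
rewrite -[X in X == _]/(Re (hc _ _)) -[X in _ == X]/(Re (hc _ _)); apply/eqP.
congr complex.Re; rewrite hcC [RHS]hcC !hc_combl; congr (_ ^*)%R.
apply: eq_bigr => p _; congr (_ * _).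
by rewrite hcC -(posdef_herm _ _ mK.1).
Qed.

Lemma ortho_h : perp shifted_graph ((h, 0) : E).
Proof.
move=> _ [s hs ->]; rewrite prod_ipE /= ip0l addr0 ipNr ipC.
by rewrite -['[_, _]]/(complex.Re (hc _ _)) hs oppr0.
Qed.

(** If [(0, v)] is orthogonal to the shifted graph then [hc (e x) v] is
   proportional to [hc (m x) h], because the functional [v] vanishes where the
   functional [h] does; as [h] is outside the domain of the adjoint, [v = 0]. *)
Lemma ortho_fst0 (d : E) : perp shifted_graph d -> d.1 = 0 -> d = 0.
Proof.
case: d => d1 v od /= d10; rewrite d10 in od *; congr (_, _).
have ov s : hc (comb m s) h = 0 -> hc (comb e s) v = 0.
  move=> hs.
  have ov' t : hc (comb m t) h = 0 -> '[comb e t, v] = 0.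
    move=> ht; have /od : shifted_graph (- comb m t, comb e t) by exists t.
    by rewrite prod_ipE /= ip0l add0r ipC.
  apply: hc_eq0; first exact: ov'.
  have := ov' (fscale 'i%C s).
  rewrite !comb_scale !cplx_scale_i hcJl hs mulr0 J_skew => /(_ erefl)/eqP.
  by rewrite oppr_eq0 => /eqP.
have [h0|/existsNP[x0 /eqP hx0]] := pselect (forall x, hc (m x) h = 0).
  by case: nh; exists 0 => x; rewrite h0 hc0r.
have vE x : hc (e x) v = hc (m x) h / hc (m x0) h * hc (e x0) v.
  have := ov [:: (1, x); (- (hc (m x) h / hc (m x0) h), x0)].
  rewrite !hc_combl !big_cons !big_nil /= !mul1r !addr0 !mulNr divfK// subrr.
  by move=> /(_ erefl)/eqP; rewrite subr_eq0 => /eqP.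
have [v0|v0] := eqVneq (hc (e x0) v) 0.
  by apply: hc_total => x; rewrite hc0l hcC vE v0 mulr0 rmorph0.
case: nh; exists (cplx_scale (hc (m x0) h / hc (e x0) v)^*%R v) => x.
rewrite hcZr conjCK (vE x).
by field; rewrite hx0 v0.
Qed.

(** In terms of [T], the operator [S] is [(1 + T^* T)^-1], the second component
   of [q k] is [T (S k)], and [A] is [S T^* T S]; its square root is the product
   of [S] and the absolute value of [T]. *)
Section Construction.
Variable P : E -> E.
Hypothesis PW : ortho_proj shifted_graph P.

Let q k : E := P (k, 0).
Let S k : H := (q k).1.
Let A k : H := S k - S (S k).

Let ip_E1 (u : E) k : '[u, (k, 0) : E] = '[u.1, k].
Proof. by rewrite prod_ipE /= ip0r addr0. Qed.

Let q_ortho k : perp shifted_graph (q k).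
Proof. by have [] := PW (k, 0). Qed.

Let qB k l : q (k - l) = q k - q l.
Proof.
rewrite /q -(symopB _ _ (ortho_proj_sym PW)); congr P.
by rewrite -[RHS]/(k - l, 0 - 0) subr0.
Qed.

Let q_ip k l : '[S k, l] = '[q k, q l].
Proof. by rewrite /S -ip_E1 [LHS]ipC -(ortho_proj_ip PW _ (q_ortho k)) ipC. Qed.

Let S_sym : symop S.
Proof. by move=> k l; rewrite q_ip ipC -q_ip ipC. Qed.

Let S_J k : J (S k) = S (J k).
Proof.
rewrite /S /q -[LHS]/((JE (q k)).1) -(ortho_proj_comm PW JE_skew shifted_graph_J).
by congr (P _).1; rewrite /JE /= J0.
Qed.

Let A_ip k l : '[A k, l] = '[(q k).2, (q l).2].
Proof. by rewrite /A ipBl (S_sym (S k)) q_ip prod_ipE addrAC subrr add0r. Qed.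

Let A_sym : symop A.
Proof. by move=> k l; rewrite A_ip ipC -A_ip ipC. Qed.

Let A_pos : posop A.
Proof. by move=> k; rewrite A_ip ip_ge0. Qed.

Let snd_le (u : E) : '[u.2] <= '[u].
Proof. by rewrite prod_ipE lerDr ip_ge0. Qed.

Let A_le1 k : '[A k, k] <= 1 * '[k].
Proof.
rewrite mul1r A_ip (le_trans (snd_le _))// (le_trans (ortho_proj_le PW _))//.
by rewrite prod_ipE /= ip0l addr0.
Qed.

Let A_J k : J (A k) = A (J k).
Proof. by rewrite /A JD JN !S_J. Qed.

Let A_h : '[A h, h] = 0.
Proof. by rewrite A_ip /q (ortho_proj_id PW ortho_h) /= ip0l. Qed.

(** The graph vector [(e x, m x)] is a limit of vectors [q k]: its component
   [d] orthogonal to the range of [q] lies in the range of [P], and has a zero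
   first component because ['[d.1, k] = '[d, q k]]. *)
Let q_dense x : exists k : nat -> H, hlim (fun n => q (k n)) ((e x, m x) : E).
Proof.
have sub : lin_subspace (fun w => exists k, w = q k).
  split=> [|a u v [k ->] [l ->]].
    by exists 0; rewrite -(subrr (0 : H)) qB subrr.
  exists (a *: k + l); rewrite /q -(symopZ _ _ (ortho_proj_sym PW)).
  rewrite -(symopD _ _ (ortho_proj_sym PW)); congr P.
  by rewrite -[LHS]/(a *: k + l, a *: 0 + 0) scaler0 addr0.
have [d [dq dad]] := ortho_decomposition ((e x, m x) : E) sub.
have d0 : d = 0.
  have pd : perp shifted_graph d.
    move=> w Ww; have wq : perp (fun w => exists k, w = q k) w.
      by move=> _ [k ->]; rewrite ipC q_ortho.
    have := adherent_ip0 wq dad.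
    by rewrite ipBl (ortho_graph x Ww) sub0r => /eqP; rewrite oppr_eq0 => /eqP.
  apply: ortho_fst0 => //; apply: ip_eq0.
  rewrite -ip_E1 -{1}(ortho_proj_id PW pd) (ortho_proj_sym PW).
  by apply: dq; exists d.1.
rewrite d0 subr0 in dad.
have [w wq wl] := adherent_hlim dad.
have /choice[k kw] := wq.
by exists k; rewrite (_ : (fun n => _) = w)//; apply/funext => n; rewrite kw.
Qed.

(** [C] maps [k] to a vector as long as the second component of [q k], so [C k]
   converges when [q k] does, and Gram matrices are preserved in the limit.
   Positivity comes from ['[C k, S k] >= 0], and [C h = 0] because
   [q h = (h, 0)]. *)
Lemma second_root_proj : exists m' : X -> H,
  root_vectors m' K /\ forall x, hc (m' x) h = 0.
Proof.
have [C [sC pC CC cC]] := sqrt_op A_sym A_pos A_le1.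
have JC k : J (C k) = C (J k) by apply: cC k; [exact: J_adjointable|exact: A_J].
have SC k : S (C k) = C (S k).
  apply: cC k; first exact: symop_adjointable S_sym.
  by move=> k; rewrite /A (symopB _ _ S_sym).
have C_ip k l : '[C k, C l] = '[(q k).2, (q l).2] by rewrite -A_ip -CC [RHS]sC.
have Ch : C h = 0 by apply: ip_eq0; rewrite -sC CC A_h.
have q2_J l : J (q l).2 = (q (J l)).2.
  rewrite -[LHS]/((JE (q l)).2) -(ortho_proj_comm PW JE_skew shifted_graph_J).
  by congr (P _).2; rewrite /JE /= J0.
(* The form of [C S] is non-negative, because [S = A + S ^ 2] and [A = C ^ 2]. *)
have CS_ge0 l : 0 <= '[C l, S l].
  have -> : S l = C (C l) + S (S l) by rewrite CC /A subrK.
  rewrite ipDr addr_ge0//; first by rewrite -sC; exact: pC.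
  by rewrite -S_sym SC; exact: pC.
have CS_J l : '[C l, J (S l)] = 0.
  have x1 : '[C l, J (S l)] = '[C (S l), J l] by rewrite S_J -S_sym SC.
  have : '[C l, J (S l)] = - '[J l, C (S l)] by rewrite sC -JC J_skew opprK.
  by rewrite (ipC (J l)) -x1; lra.
have /choice[k kP] := q_dense.
have /choice[m' m'P] x : exists l, hlim (fun n => C (k x n)) l.
  apply: hlim_ex => eps /(hlim_cauchy (kP x))[N NP]; exists N => i j Nj ji.
  rewrite -(symopB _ _ sC) C_ip qB (le_trans (snd_le _))//.
  by rewrite NP// (leq_trans Nj).
have q2 x : hlim (fun n => (q (k x n)).2) (m x).
  apply: (@hlim_contract _ E H snd 1 _ _ _ (kP x)) => u v.
  by rewrite mul1r; exact: snd_le (u - v).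
have S1 x : hlim (fun n => S (k x n)) (e x).
  apply: (@hlim_contract _ E H fst 1 _ _ _ (kP x)) => u v.
  by rewrite mul1r [leRHS]prod_ipE lerDl ip_ge0.
exists m'; split; last first.
  move=> x; apply: hc_eq0.
    apply: (cvg_unique _ (hlim_ipl (w := h) (m'P x))) => //.
    have -> : (fun n => '[C (k x n), h]) = fun=> 0.
      by apply/funext => n; rewrite sC Ch ip0r.
    exact: cvg_cst.
  apply: (cvg_unique _ (hlim_ipl (w := J h) (m'P x))) => //.
  have -> : (fun n => '[C (k x n), J h]) = fun=> 0.
    by apply/funext => n; rewrite sC -JC Ch J0 ip0r.
  exact: cvg_cst.
split; last first.
  move=> x y; rewrite -mK.2; apply: complex_eq; rewrite /hc /=.
    apply: (cvg_unique _ (hlim_ip (m'P x) (m'P y))) => //.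
    have -> : (fun n => '[C (k x n), C (k y n)]) =
      (fun n => '[(q (k x n)).2, (q (k y n)).2]) by apply/funext => n.
    exact: hlim_ip.
  apply: (cvg_unique _ (hlim_ip (m'P x) (hlim_J (m'P y)))) => //.
  have -> : (fun n => '[C (k x n), J (C (k y n))]) =
      (fun n => '[(q (k x n)).2, J (q (k y n)).2]).
    by apply/funext => n; rewrite JC C_ip -q2_J.
  by apply: hlim_ip => //; exact: hlim_J.
apply/posdefP => s; rewrite -(hc_comb m' e) lecE /=.
have kC : hlim (fun n => comb (fun x => C (k x n)) s) (comb m' s).
  exact: (@hlim_comb _ _ _ (fun n x => C (k x n))).
have kS : hlim (fun n => comb (fun x => S (k x n)) s) (comb e s).
  exact: (@hlim_comb _ _ _ (fun n x => S (k x n))).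
pose c n := comb (k ^~ n) s.
have cC' n : comb (fun x => C (k x n)) s = C (c n) by rewrite symop_comb.
have cS' n : comb (fun x => S (k x n)) s = S (c n).
  by rewrite symop_comb//; exact: S_J.
apply/andP; split.
  apply/eqP; apply: (cvg_unique _ (hlim_ip kC (hlim_J kS))) => //.
  rewrite (_ : (fun n => _) = fun=> 0); first exact: cvg_cst.
  by apply/funext => n; rewrite cC' cS' CS_J.
apply: (cvgn_ge_bound (hlim_ip kC kS)) => n; rewrite cC' cS'.
exact: CS_ge0.
Qed.

End Construction.

Lemma second_root : exists m' : X -> H,
  root_vectors m' K /\ forall x, hc (m' x) h = 0.
Proof.
have [P PW] := ortho_proj_ex shifted_graph_subspace.
exact: second_root_proj PW.
Qed.

End SecondRoot.

(** * The characterization *)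

Theorem theorem1p3 (R : realType) (X : choiceType) (hX : [set: X] !=set0)
    (K : X -> X -> R[i]) (hK : posdef K) :
  ((exists! M : X -> X -> R[i], matrix_sqrt M K) <->
   (forall L : X -> X -> R[i], posdef L -> dominated L K ->
      exists M : X -> X -> R[i], matrix_sqrt M L)) /\
  ((forall L : X -> X -> R[i], posdef L -> dominated L K ->
      exists M : X -> X -> R[i], matrix_sqrt M L) <->
   (exists2 c : R, 0 < c & dominated K (fun x y => c%:C * delta R X x y))).
Proof.
pose H := l2_based R X.
have bounded_unique : bounded_kernel K -> exists! M, matrix_sqrt M K.
  move=> [c c0 Kc]; have [M MK] := bounded_root H hK Kc.
  exists M; split=> // N NK.
  exact: (root_unique H (ltW c0) Kc MK NK).
have unique_bounded : (exists! M, matrix_sqrt M K) -> bounded_kernel K.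
  move=> [M [MK uniq]]; apply: contrapT => unb.
  have [m mK mE] := matrix_sqrt_vectors H MK.
  have [h nh] := unbounded_adjoint_dom mK.2 unb.
  have [m' [m'K m'h]] := second_root mK nh.
  apply: nh; exists 0 => x; rewrite hc0r -(m'h x); congr hc.
  apply: hc_total => y; rewrite -mE.
  by rewrite (uniq _ (root_vectors_sqrt m'K)).
have bounded_sub : bounded_kernel K -> forall L : X -> X -> R[i],
    posdef L -> dominated L K -> exists M, matrix_sqrt M L.
  by move=> [c _ Kc] L pL LK; exact: (bounded_root H pL (dominated_trans LK Kc)).
have sub_bounded : (forall L : X -> X -> R[i],
    posdef L -> dominated L K -> exists M, matrix_sqrt M L) -> bounded_kernel K.
  move=> sub; apply: contrapT => unb.
  have [|M MK] := sub K hK.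
    by apply/posdefP => s; rewrite kformB subrr.
  have [m mK _] := matrix_sqrt_vectors H MK.
  by have [L [pL LK nL]] := unbounded_no_root mK unb; exact/nL/sub.
split; split.
- by move=> /unique_bounded; exact: bounded_sub.
- by move=> /sub_bounded; exact: bounded_unique.
- exact: sub_bounded.
- exact: bounded_sub.
Qed.
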